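(* Let $b$ be a prime power, $s\ge 1$, and let $(\mathbf x_n)_{n\ge 0}$ be a generalized Niederreiter sequence over $\mathbb F_b$ built from pairwise coprime polynomials $p_1,\dots,p_s\in\mathbb F_b[x]$ with $e_i=\deg p_i\ge 1$ and polynomials $y_{i,j,k}$ (construction in the context). Put $e_0=e_1+\dots+e_s$, $e=e_1e_2\cdots e_s$, $t=e_0-s$, $d=e_0$, and $K_{d,t,s}=4(d+t)(s-1)^2$. Then $(\mathbf x_n)_{n\ge0}$ is $d$-admissible in base $b$. Moreover: (a) If $s\ge 2$, $\eta_1=s/(s+1)$ and $m\ge 9(d+t)es(s+1)$, then $$1+\min_{0\le Q<b^m}\ \min_{\mathbf w\in E_m^s}\ \max_{1\le N\le b^m} N D^*\big((\mathbf x_{n\oplus Q}\oplus\mathbf w)_{0\le n<N}\big)\ \ge\ 2^{-2}b^{-d}K_{d,t,s+1}^{-s}\,\eta_1^s\,m^s .$$ (b) Let $s\ge 3$, $\eta_2\in(0,1)$ and $m\ge 8(d+t)e(s-1)^2\eta_2^{-1}+2(1+t)\eta_2^{-1}(1-\eta_2)^{-1}$. Suppose that for some $i_0\in\{1,\dots,s\}$ $$\min_{m/2-t\le je_{i_0}\le m,\ 0\le k<e_{i_0}}\Big(1-\frac{\deg y_{i_0,j,k}}{j\,e_{i_0}}\Big)\ge \eta_2 .$$ Then $$\min_{\mathbf w\in E_m^s} b^m D^*\big((\mathbf x_n\oplus\mathbf w)_{0\le n<b^m}\big)\ \ge\ 2^{-2}b^{-d}K_{d,t,s}^{-s+1}\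,\eta_2^{s-1}\,m^{s-1}.$$
   Context: **Generalized Niederreiter sequence.** For each $1\le i\le s$ and $j\ge1$, polynomials $y_{i,j,k}\in\mathbb F_b[x]$, $0\le k<e_i$, are given which are linearly independent over $\mathbb F_b$ modulo $p_i$. Expand in $\mathbb F_b((x^{-1}))$: $\dfrac{y_{i,j,k}(x)}{p_i(x)^j}=\sum_{r\ge0}a^{(i)}(j,k,r)x^{-r-1}$ (such an expansion presupposes $\deg y_{i,j,k}<je_i$). Define $C^{(i)}=(c^{(i)}_{j,r})_{j\ge1,r\ge0}$ by $c^{(i)}_{j,r}=a^{(i)}(Q+1,k,r)$, where $j-1=Qe_i+k$ with integers $Q\ge 0$ and $0\le k<e_i$. The sequence $(\mathbf x_n)_{n\ge0}$ is the digital sequence generated by $C^{(1)},\dots,C^{(s)}$. **Digital sequence.** Let $Z_b=\{0,\dots,b-1\}$ and fix a bijection $\phi:Z_b\to\mathbb F_b$ with $\phi(0)=0$. For $n=\sum_{r\ge0}a_r(n)b^r$ with $a_r(n)\in Z_b$, put $y^{(i)}_{n,j}=\sum_{r\ge0}c^{(i)}_{j,r}\phi(a_r(n))$, $x^{(i)}_n=\sum_{j\ge1}\phi^{-1}(y^{(i)}_{n,j})b^{-j}$, $\mathbf x_n=(x^{(1)}_n,\dots,x^{(s)}_n)$. The $b$-adic digits of $x_n^{(i)}$ are understood to be the $\phi^{-1}(y^{(i)}_{n,j})$. **Digitwise operations.** For $x=\sum_{j\ge1}x_jb^{-j}$, $y=\sum_{j\ge1}y_jb^{-j}$ with digits in $Z_b$,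 $x\oplus y$ (resp. $x\ominus y$) has digits $x_j+y_j$ (resp. $x_j-y_j$) reduced mod $b$ to $Z_b$; for vectors it is applied coordinatewise. For integers $0\le n_1,n_2<b^m$, $n_1\oplus n_2:=b^m\big((n_1b^{-m})\oplus(n_2b^{-m})\big)$, similarly for $\ominus$. $E_m=\{kb^{-m}:0\le k<b^m\}$ and $E_m^s$ is its $s$-fold Cartesian power. **Discrepancy.** For $N$ points $\beta_0,\dots,\beta_{N-1}$ in the unit cube, $D^*((\beta_n)_{0\le n<N})=\sup_{0<y_1,\dots,y_s\le1}\big|\tfrac1N\#\{0\le n<N:\beta_n\in\prod_{i}[0,y_i)\}-y_1\cdots y_s\big|$. **Admissibility.** For $x=\sum_{j\ge1} x_jb^{-j}$ with $x_1=\dots=x_k=0$, $x_{k+1}\ne0$, put $\|x\|_b=b^{-k-1}$, with $\|0\|_b=0$; for $\mathbf x=(x^{(1)},\dots,x^{(s)})$, $\|\mathbf x\|_b=\prod_i\|x^{(i)}\|_b$; for an integer $n\in[b^k,b^{k+1})$, $\|n\|_b=b^k$. A sequence $(\mathbf x_n)_{n\ge0}$ is $d$-admissible in base $b$ if $\inf_{n>k\ge0}\|n\ominus k\|_b\,\|\mathbf x_n\ominus\mathbf x_k\|_b\ge b^{-d}$. *)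

(* Defs.v *)
From HB Require Import structures.
From mathcomp Require Import all_boot all_order all_algebra.
From mathcomp Require Import all_classical all_reals all_analysis.

Set Implicit Arguments.
Unset Strict Implicit.
Unset Printing Implicit Defensive.

Import Order.TTheory GRing.Theory Num.Theory.
Import numFieldNormedType.Exports.

Local Open Scope classical_set_scope.
Local Open Scope ring_scope.

Definition pdeg (F : fieldType) (q : {poly F}) : nat := (size q).-1.

(* Elements of F((x^-1)) are given by their coefficients; the value at n : int
   is the coefficient of x^n. *)
Definition laurent_of_poly (F : fieldType) (q : {poly F}) (n : int) : F :=
  if n is Posz l then q`_l else 0.

(* \sum_(r >= 0) a r * x^(- r - 1); recall that Negz r is - r - 1. *)
Definition laurent_of_tail (F : fieldType) (a : nat -> F) (n : int) : F :=
  if n is Negz r then a r else 0.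

(* Product in F((x^-1)) of a polynomial with a Laurent series. *)
Definition laurent_mulp (F : fieldType) (q : {poly F}) (L : int -> F) (n : int) : F :=
  \sum_(l < size q) q`_l * L (n - (l : nat)%:Z).

(* For q != 0: y / q = \sum_(r >= 0) a r * x^(- r - 1) in F((x^-1)).
   Such an a exists iff deg y < deg q, and it is then unique. *)
Definition expansion (F : fieldType) (y q : {poly F}) (a : nat -> F) : Prop :=
  forall n : int, laurent_mulp q (laurent_of_tail a) n = laurent_of_poly y n.

Definition lin_indep_mod (F : fieldType) (q : {poly F}) (n : nat)
    (v : nat -> {poly F}) : Prop :=
  forall c : 'I_n -> F, (q %| \sum_(k < n) c k *: v k)%R -> forall k, c k = 0.

(* Row j of the matrix (indexed from 0) is the row c_{j+1} of the usual
   indexing from 1, so that j = Q * e + k with Q = j %/ e and k = j %% e. *)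
Definition niederreiter_matrix (F : fieldType) (e : nat)
    (a : nat -> nat -> nat -> F) (j r : nat) : F :=
  a (j %/ e).+1 (j %% e)%N r.

(* A point of [0, 1] is represented by a sequence of b-adic digits, where
   x j : nat, assumed to be < b, is the digit of b^-(j + 1). *)
Definition digits := nat -> nat.

Definition digits_val (R : realType) (b : nat) (x : digits) : R :=
  limn (series (fun j : nat => (x j)%:R * b%:R ^- j.+1 : R) : R^nat).

Definition ndigit (b n r : nat) : nat := ((n %/ b ^ r) %% b)%N.

Definition ndigitZ (F : finFieldType) (n r : nat) : 'I_#|F| :=
  Ordinal (ltn_pmod (n %/ #|F| ^ r) (ltnW (card_finNzRing_gt1 F))).

(* The sum over r >= 0 stops at r < n because the digits of n of index
   r >= n vanish and phi 0 = 0. *)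
Definition digital_seq (F : finFieldType) (s : nat)
    (phi : 'I_#|F| -> F) (phi_inv : F -> 'I_#|F|)
    (C : 'I_s -> nat -> nat -> F) (n : nat) (i : 'I_s) : digits :=
  fun j => phi_inv (\sum_(r < n) C i j r * phi (ndigitZ F n r)).

Definition doplus (b : nat) (x y : digits) : digits :=
  fun j => ((x j + y j) %% b)%N.

Definition dominus (b : nat) (x y : digits) : digits :=
  fun j => ((x j + (b - y j)) %% b)%N.

(* Digits of index r >= maxn n1 n2 of n1 and n2 vanish (for b >= 2). *)
Definition noplus (b n1 n2 : nat) : nat :=
  (\sum_(r < maxn n1 n2) ((ndigit b n1 r + ndigit b n2 r) %% b) * b ^ r)%N.

Definition nominus (b n1 n2 : nat) : nat :=
  (\sum_(r < maxn n1 n2)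
     ((ndigit b n1 r + (b - ndigit b n2 r)) %% b) * b ^ r)%N.

(* The b-adic digits of k * b^-m, namely floor (k * b^-m * b^(j+1)) mod b. *)
Definition frac_digits (b m k : nat) : digits :=
  fun j => ((k * b ^ j.+1) %/ b ^ m %% b)%N.

Definition Em (b m : nat) : set digits :=
  [set frac_digits b m k | k in [set k : nat | (k < b ^ m)%N]].

Definition Ems (b m s : nat) : set ('I_s -> digits) :=
  [set w | forall i, Em b m (w i)].

Definition star_discrepancy (R : realType) (s N : nat)
    (beta : nat -> 'I_s -> R) : R :=
  sup [set z | exists2 y : 'I_s -> R, (forall i, 0 < y i <= 1) &
    z = `| #|[pred n : 'I_N | [forall i, 0 <= beta n i < y i]]|%:R / N%:R
           - \prod_(i < s) y i | ].

Definition digits_norm (R : realType) (b : nat) (x : digits) : R :=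
  if pselect (exists k, x k != 0%N) is left h then b%:R ^- (ex_minn h).+1 else 0.

Definition digits_vnorm (R : realType) (b s : nat) (x : 'I_s -> digits) : R :=
  \prod_(i < s) digits_norm R b (x i).

(* Only meaningful for n >= 1: b ^ k where b ^ k <= n < b ^ k.+1. *)
Definition nat_norm (b n : nat) : nat := (b ^ trunc_log b n)%N.

Definition admissible (R : realType) (b s d : nat)
    (x : nat -> 'I_s -> digits) : Prop :=
  b%:R ^- d <=
  inf [set z : R | exists n k : nat, (k < n)%N /\
    z = (nat_norm b (nominus b n k))%:R
        * digits_vnorm R b (fun i => dominus b (x n i) (x k i))].

(* Minimum and maximum of f over A; these are only used for finite nonempty
   f @` A, where the bounds are attained. *)
Definition min_over (R : realType) (T : Type) (A : set T) (f : T -> R) : R :=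
  inf [set f x | x in A].

Definition max_over (R : realType) (T : Type) (A : set T) (f : T -> R) : R :=
  sup [set f x | x in A].

Definition Kdts (d t s : nat) : nat := (4 * (d + t) * (s - 1) ^ 2)%N.

(* Main.v *)
From mathcomp Require Import zify ring lra.
Require Import Defs.
From HB Require Import structures.
From mathcomp Require Import all_boot all_order all_algebra.
From mathcomp Require Import all_classical all_reals all_analysis.

Set Implicit Arguments.
Unset Strict Implicit.
Unset Printing Implicit Defensive.

Import Order.TTheory GRing.Theory Num.Theory.
Import numFieldNormedType.Exports.

Local Open Scope classical_set_scope.
Local Open Scope ring_scope.

(** Both discrepancy bounds come from one corner [Y] of the unit cube whose
    anchored box contains far fewer points than its volume predicts.

    Write the box [[0, Y)] as the disjoint union of the boxes [B_r], where [r_i]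
    is the first digit at which coordinate [i] of a point falls below [Y].  The
    side of [B_r] in direction [i] is [Y_(i, r_i) b^-(r_i + 1)], so [B_r] is a
    union of elementary boxes of volume [b^-(\sum_i (r_i + 1))].  The digits of
    the points form a [(t, m)]-net, hence [B_r] holds exactly the expected number
    of points when [\sum_i (r_i + 1) <= m - t].  If the digits of [Y] are copied
    from a point [z] of the net, then a point in [B_r] shares its first [r_i]
    digits with [z] in each direction, and admissibility forbids this when
    [\sum_i (r_i + 1) > m + d].  Such boxes are empty, and each of them that has
    [\sum_i (r_i + 1) = m + d + 1] and the digits [b - 1] on its corner
    contributes a deficit of at least [(b - 1) b^-(d + 1)] ([box_sum]).

    Nothing is known about the boxes between the two thresholds, so the digits of
    [Y] are made to avoid them: the nonzero digits sit at positions that are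
    [d + t + 1] apart, which makes the sums [\sum_i (r_i + 1)] jump over the
    critical range ([spaced_corner]).  One coordinate, the far one, carries its
    spaced digits around position [m], the others near position [0]; this leaves
    [G ^ n] admissible choices of [r] when there are [n] near coordinates with
    [G] nonzero digits each.  Truncating [z] after its prescribed digits gives
    [Y].  Real points can have a digit expansion ending in [b - 1], but such
    points can only be missing from the box, which does not spoil the deficit.

    It remains to find a net point with prescribed digits, that is, to prove that
    certain rows of the generating matrices, cut to [m] columns, are linearly
    independent.  A row is treated as the functional on polynomials that sends
    [u] to the residue of [u y / p^j]; it vanishes on the multiples of [p^j].
    Independence of the [y_(i, j, k)] modulo [p_i] and coprimality of the [p_i]
    show that the rows are independent as functionals ([rows_free]), and a
    combination of rows vanishing on a window of [deg P] consecutive powers of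
    [x], where [P] is the product of the moduli, vanishes on everything up to the
    common factor of [P] and a power of [x] ([rows_window]).  The same facts give
    the net property, and admissibility itself ([common_zeros]).

    For (a) the coordinates are the [s] coordinates of the sequence and, as the
    far one, the index [n] read from its leading digit: the box in the last
    direction is the range [n < N].  For (b) the far coordinate is [i_0], and the
    degree hypothesis makes its rows around position [m] vanish on the first
    columns, where the near rows are already independent. *)

(** * Boxes between a point and the origin *)

Definition agree (x c : nat -> nat) (k : nat) : bool :=
  all (fun j => x j == c j) (iota 0 k).

Lemma agreeP (x c : nat -> nat) (k : nat) :
  reflect (forall j, (j < k)%N -> x j = c j) (agree x c k).
Proof.
apply: (iffP allP) => [h j jk|h j].
  by apply/eqP/h; rewrite mem_iota.
by rewrite mem_iota /= => jk; apply/eqP/h.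
Qed.

Definition branches (x c : nat -> nat) (j : nat) : bool :=
  agree x c j && (x j < c j)%N.

Definition lex_below (M : nat) (x c : nat -> nat) : bool :=
  [exists j : 'I_M, branches x c j].

(** The counting property of a [(t, m)]-net and the separation property of a
    [d]-admissible set, for points given by digits.  Counts are only bounded from
    above because the argument produces a deficit of points. *)
Record admissible_net (b m d t : nat) (I T : finType)
    (X : T -> I -> nat -> nat) : Prop := AdmissibleNet {
  net_digit : forall n i j, (X n i j < b)%N;
  net_card : forall (r : I -> nat) (c : I -> nat -> nat),
    (forall i j, (c i j < b)%N) -> (\sum_i r i + t <= m)%N ->
    (#|[pred n | [forall i, agree (X n i) (c i) (r i)]]|
       <= b ^ (m - \sum_i r i))%N;
  net_sep : forall n n' (r : I -> nat), n != n' ->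
    (forall i, agree (X n i) (X n' i) (r i)) -> (\sum_i (r i).+1 <= m + d)%N }.

Section BoxSum.
Variables (R : realFieldType) (b m d t M : nat) (I : finType) (T : finType).
Variable X : T -> I -> nat -> nat.
Hypothesis b_gt1 : (1 < b)%N.
Hypothesis X_net : admissible_net b m d t X.
(* The point [z] agrees with [Y] up to the last nonzero digit of [Y], and [Y_gap]
   says that the nonzero digits of [Y] avoid the range of depths on which neither
   counting nor separation gives information. *)
Variables (i0 : I) (z : T) (Y : I -> nat -> nat).
Hypothesis Y_lt : forall i j, (Y i j < b)%N.
Hypothesis Y_z : forall i j, Y i j != 0%N -> agree (X z i) (Y i) j.+1.
Hypothesis Y_gap : forall r : I -> nat, (forall i, (r i < M)%N) ->
  (forall i, Y i (r i) != 0%N) ->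
  (\sum_i (r i).+1 + t <= m)%N \/ (m + d < \sum_i (r i).+1)%N.

Let box (r : I -> nat) : pred T :=
  [pred n | [forall i, branches (X n i) (Y i) (r i)]].

(** Splitting by the digits [c_i < Y i (r i)] taken at the branching positions
    turns the box into elementary boxes of equal volume. *)
Lemma card_box_shallow (r : {ffun I -> 'I_M}) :
  (\sum_i (r i).+1 + t <= m)%N ->
  (#|box (fun i => r i)|
    <= (\prod_i Y i (r i)) * b ^ (m - \sum_i (r i : nat).+1))%N.
Proof.
move=> hr; pose fam := family (fun i => [pred c : 'I_b | (c < Y i (r i))%N]).
pose f (n : T) : {ffun I -> 'I_b} := [ffun i => Ordinal (net_digit X_net n i (r i))].
have -> : #|box (fun i => r i)| =
    (\sum_(c in fam) #|[pred n in box (fun i => r i) | f n == c]|)%N.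
  rewrite -sum1_card (partition_big f (mem fam)) /=; last first.
    move=> n /forallP hn; apply/familyP => i; rewrite ffunE !inE /=.
    by have /andP[] := hn i.
  by apply: eq_bigr => c _; rewrite -sum1_card; apply: eq_bigl => n; rewrite !inE.
have card_fam : #|fam| = (\prod_i Y i (r i))%N.
  rewrite card_family foldrE big_image /=; apply: eq_bigr => i _.
  rewrite -[RHS]card_ord -!sum1_card.
  rewrite (big_ord_widen b (fun=> 1%N) (ltnW (Y_lt i (r i)))).
  exact: eq_bigl.
rewrite -card_fam -sum_nat_const; apply: leq_sum => c _.
pose c' i j := if (j < r i)%N then Y i j else c i : nat.
have c'_lt i j : (c' i j < b)%N by rewrite /c'; case: ifP.
apply: leq_trans (net_card X_net c'_lt hr); apply: subset_leq_card.
apply/fintype.subsetP => n; rewrite !inE => /andP[/forallP hn /eqP fnc].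
apply/forallP => i; apply/agreeP => j; rewrite ltnS leq_eqVlt /c'.
have /andP[/agreeP ha _] := hn i.
case/orP => [/eqP ->|jr]; last by rewrite jr; apply: ha.
by rewrite ltnn -fnc ffunE.
Qed.

(** A point of the box shares with [z] all digits before the branching positions,
    and it differs from [z] at these positions. *)
Lemma card_box_deep (r : {ffun I -> 'I_M}) :
  (m + d < \sum_i (r i).+1)%N -> #|box (fun i => r i)| = 0%N.
Proof.
move=> hr; apply: eq_card0 => n; rewrite !inE; apply/negP => /forallP hn.
have hz i : Y i (r i) != 0%N.
  by have /andP[_] := hn i; case: (Y i (r i)).
have nz : n != z.
  apply/eqP => nz; have /andP[_] := hn i0.
  by rewrite nz; have /agreeP -> := Y_z (hz i0); rewrite ?ltnn.
have := net_sep X_net (r := fun i => r i) nz; rewrite leqNgt hr => h.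
apply: notF; apply: h => i; apply/agreeP => j jr.
have /andP[/agreeP/(_ j jr) -> _] := hn i.
by have /agreeP/(_ j (leqW jr)) -> := Y_z (hz i).
Qed.

(** Expanding the volume [\prod_i \sum_j] by distributivity matches it term by
    term with the boxes: shallow terms cancel, deep ones are pure gain, and
    [Good] collects deep ones whose gain is easy to bound. *)
Lemma box_sum (Good : {set {ffun I -> 'I_M}}) :
  (forall r : {ffun I -> 'I_M}, r \in Good ->
    \sum_i (r i : nat).+1 = (m + d).+1 /\ forall i, Y i (r i) = b.-1)%N ->
  #|[pred n | [forall i, lex_below M (X n i) (Y i)]]|%:R
    + #|Good|%:R * (b.-1%:R * b%:R ^- d.+1)
  <= b%:R ^+ m * \prod_i \sum_(j < M) (Y i j)%:R * b%:R ^- j.+1 :> R.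
Proof.
move=> Good_spec.
have b_gt0 : (0 : R) < b%:R by rewrite ltr0n ltnW.
have b_neq0 : (b%:R : R) != 0 by rewrite gt_eqF.
pose gain (r : {ffun I -> 'I_M}) : R :=
  if r \in Good then b.-1%:R * b%:R ^- d.+1 else 0.
have -> : #|Good|%:R * (b.-1%:R * b%:R ^- d.+1) = \sum_r gain r :> R.
  by rewrite -big_mkcond /= sumr_const -[RHS]mulr_natl.
have card_le : (#|[pred n | [forall i, lex_below M (X n i) (Y i)]]|
    <= \sum_(r : {ffun I -> 'I_M}) #|box (fun i => r i)|)%N.
  under eq_bigr => r _ do rewrite -sum1_card big_mkcond.
  rewrite exchange_big /= -sum1_card big_mkcond /=.
  apply: leq_sum => n _; rewrite !inE; case: ifP => // /forallP hn.
  have hn' i : exists j : 'I_M, branches (X n i) (Y i) j by apply/existsP/hn.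
  pose r : {ffun I -> 'I_M} := [ffun i => xchoose (hn' i)].
  rewrite (bigD1 r) //= !inE.
  suff -> : [forall i, branches (X n i) (Y i) (r i)] by [].
  by apply/forallP => i; rewrite ffunE; apply: (xchooseP (hn' i)).
apply: (@le_trans _ _ (\sum_(r : {ffun I -> 'I_M})
    (#|box (fun i => r i)|%:R + gain r))).
  by rewrite big_split /= lerD2r -natr_sum ler_nat.
rewrite bigA_distr_bigA /= mulr_sumr; apply: ler_sum => r _.
rewrite big_split /= -natr_prod prodfV -expr_sum.
have [Y0|Yn0] := boolP [exists i, Y i (r i) == 0%N].
  have /existsP[i /eqP Yi] := Y0.
  have -> : #|box (fun i => r i)| = 0%N.
    apply: eq_card0 => n; rewrite !inE; apply/negP => /forallP /(_ i).
    by rewrite /branches Yi ltn0 andbF.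
  have -> : gain r = 0.
    rewrite /gain; case: ifP => // /Good_spec[_ /(_ i)]; rewrite Yi.
    by case: b b_gt1 => [|[|b']].
  by rewrite addr0 mulr_ge0 ?exprn_ge0 ?(ltW b_gt0)// mulr_ge0 ?invr_ge0 ?exprn_ge0 ?(ltW b_gt0).
have Yn i : Y i (r i) != 0%N.
  by apply: contraNneq Yn0 => Yi; apply/existsP; exists i; rewrite Yi.
case: (Y_gap (r := fun i => r i) _ Yn) => [//|sh|dp].
  have -> : gain r = 0.
    rewrite /gain; case: ifP => // /Good_spec[hs _]; move: sh; rewrite hs.
    by lia.
  rewrite addr0; apply: (le_trans (y := ((\prod_i Y i (r i)) * b ^ (m - \sum_i (r i : nat).+1))%N%:R)).
    by rewrite ler_nat card_box_shallow.
  rewrite natrM natrX mulrCA ler_wpM2l// -expfB_cond ?(negPf b_neq0)//=.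
  lia.
rewrite card_box_deep// add0r /gain; case: ifP => [|_]; last first.
  by rewrite mulr_ge0 ?exprn_ge0 ?(ltW b_gt0)// mulr_ge0 ?invr_ge0 ?exprn_ge0 ?(ltW b_gt0).
move=> /Good_spec[-> hY].
rewrite mulrCA -addnS exprD invfM mulVKf ?expf_neq0//.
apply: ler_wpM2r; first by rewrite invr_ge0 exprn_ge0// ltW.
rewrite ler_nat (bigD1 i0)//= hY leq_pmulr// prodn_gt0// => i.
by rewrite hY; case: b b_gt1 => [|[|]].
Qed.

End BoxSum.
(** * A corner with widely spaced digits *)

Section SpacedCorner.
Variables (R : realFieldType) (b m d t : nat) (I : finType) (T : finType).
Variable X : T -> I -> nat -> nat.
Hypothesis b_gt1 : (1 < b)%N.
Hypothesis X_net : admissible_net b m d t X.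
Variables (i0 : I) (U : I -> nat) (G : nat).
Hypothesis G_gt0 : (0 < G)%N.
Variables (u nI : nat).
Hypothesis U_sum : (\sum_(i | i != i0) U i)%N = u.
Hypothesis I_card : #|I| = nI.+1.
Hypothesis nI_gt0 : (0 < nI)%N.

Let Sp := (d + t).+1.

Hypothesis fits : (t + u + Sp * G * nI <= m)%N.

(* Counted from 1, the nonzero near digits are at the positions [U i + Sp * g],
   [1 <= g <= G], and the far ones at [m + d + 1 - u - Sp * h].  The offsets [U]
   leave room for leading zeros.  Below the window of [z_far] the digits of [z]
   are arbitrary: boxes branching there are shallow in any case. *)
Variable z : T.
Hypothesis z_near : forall i j, i != i0 -> (j < U i + Sp * G)%N ->
  X z i j = if (U i < j.+1)%N && (Sp %| j.+1 - U i)%N then b.-1 else 0%N.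
Hypothesis z_far : forall j,
  (m - (t + u + Sp * G * nI) <= j < (m + d).+1 - (u + Sp * nI))%N ->
  X z i0 j = if (Sp %| (m + d).+1 - u - j.+1)%N then b.-1 else 0%N.

Let W i := if i == i0 then ((m + d).+1 - (u + Sp * nI))%N else (U i + Sp * G)%N.
Let Y i j := if (j < W i)%N then X z i j else 0%N.

Let card_near : #|predC1 i0| = nI.
Proof. by rewrite cardC1 I_card. Qed.

Let Y_z i j : Y i j != 0%N -> agree (X z i) (Y i) j.+1.
Proof.
rewrite {1}/Y; case: ifP => // jW _; apply/agreeP => j' j'j.
by rewrite /Y (leq_ltn_trans _ jW).
Qed.

Let sum_near (f : I -> nat) :
  (\sum_(i | i != i0) (U i + Sp * f i) = u + Sp * \sum_(i | i != i0) f i)%N.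
Proof. by rewrite big_split /= U_sum -big_distrr. Qed.

(* The branching positions in the near directions are [U i + Sp * f i] with
   [f i <= G]. *)
Let near_digit (r : I -> nat) : (forall i, Y i (r i) != 0%N) ->
  exists2 f : I -> nat, (forall i, i != i0 -> (r i).+1 = U i + Sp * f i)%N
    & (\sum_(i | i != i0) f i <= nI * G)%N.
Proof.
move=> Yr; exists (fun i => ((r i).+1 - U i) %/ Sp)%N.
  move=> i ii0; have := Yr i; rewrite /Y /W (negPf ii0); case: ifP => // rW.
  by rewrite z_near//; case: ifP => // /andP[Ur dv] _; rewrite mulnC divnK//; lia.
rewrite -card_near -sum_nat_const; apply: leq_sum => i ii0.
have := Yr i; rewrite /Y /W (negPf ii0); case: ifP => // rW _.
have -> : G = (Sp * G %/ Sp)%N by rewrite mulKn.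
by apply: leq_div2r; lia.
Qed.

Let Y_gap (r : I -> nat) : (forall i, (r i < m)%N) ->
  (forall i, Y i (r i) != 0%N) ->
  (\sum_i (r i).+1 + t <= m)%N \/ (m + d < \sum_i (r i).+1)%N.
Proof.
move=> _ Yr; have [f rf f_le] := near_digit Yr.
have SpG : (Sp * \sum_(i | i != i0) f i <= Sp * G * nI)%N.
  by rewrite -mulnA leq_mul2l [(G * _)%N]mulnC f_le orbT.
rewrite (bigD1 i0) //= (eq_bigr _ rf) sum_near.
have [r_lo|r_hi] := ltnP (r i0) (m - (t + u + Sp * G * nI)).
  by left; move: r_lo SpG fits; set x := (Sp * \sum_(i | _) _)%N; lia.
have := Yr i0; rewrite /Y /W eqxx; case: ifP => // rW.
rewrite z_far ?r_hi//; case: ifP => // /dvdnP[h hE] _.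
(* The depth is [m + d + 1 + Sp * (\sum_i f i - h)], so it is at least
   [m + d + 1], or at most [m + d + 1 - Sp = m - t]. *)
have rE : ((r i0).+1 + h * Sp + u = (m + d).+1)%N by lia.
have [hf|hf] := leqP h (\sum_(i | i != i0) f i).
  right; have : (h * Sp <= Sp * \sum_(i | i != i0) f i)%N.
    by rewrite mulnC leq_mul2l hf orbT.
  set x := (Sp * \sum_(i | _) _)%N; lia.
left; have : (Sp * (\sum_(i | i != i0) f i).+1 <= h * Sp)%N.
  by rewrite [(h * _)%N]mulnC leq_mul2l hf orbT.
rewrite mulnS /Sp; set x := (_ * \sum_(i | _) _)%N; lia.
Qed.

(* Free choice of the near positions; the far position then makes the depth equal
   to [m + d + 1]. *)
Let gpos (g : {ffun I -> 'I_G}) i : nat :=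
  if i == i0 then ((m + d).+1 - u - Sp * \sum_(i | i != i0) (g i).+1).-1
  else (U i + Sp * (g i).+1).-1.

Let sum_g (g : {ffun I -> 'I_G}) :
  (nI <= \sum_(i | i != i0) (g i).+1 <= nI * G)%N.
Proof.
rewrite -card_near -sum_nat_const -[X in (X <= _)%N]muln1 -sum_nat_const.
by rewrite !leq_sum.
Qed.

Let gposE (g : {ffun I -> 'I_G}) :
  (\sum_i (gpos g i).+1 = (m + d).+1)%N /\
  forall i, (gpos g i < m)%N /\ Y i (gpos g i) = b.-1.
Proof.
have /andP[g_lo g_hi] := sum_g g.
have SpG : (Sp * \sum_(i | i != i0) (g i).+1 <= Sp * G * nI)%N.
  by rewrite -mulnA leq_mul2l [(G * _)%N]mulnC g_hi orbT.
have SpL : (Sp * nI <= Sp * \sum_(i | i != i0) (g i).+1)%N.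
  by rewrite leq_mul2l g_lo orbT.
have Sp_le : (Sp <= Sp * nI)%N by rewrite leq_pmulr.
have Sp_ge : (d + t < Sp)%N by [].
split.
  have nearE i : i != i0 -> (gpos g i).+1 = (U i + Sp * (g i).+1)%N.
    by move=> ii0; rewrite /gpos (negPf ii0) prednK// addn_gt0 muln_gt0 orbT.
  rewrite (bigD1 i0) //= (eq_bigr _ nearE) /gpos eqxx.
  rewrite sum_near; move: SpG SpL fits Sp_le Sp_ge.
  set x := (Sp * \sum_(i | _) _)%N; lia.
move=> i; have [->|ii0] := eqVneq i i0.
  rewrite /gpos eqxx; move: (SpG) (SpL) => SpG' SpL'.
  have dv : (Sp %| Sp * \sum_(i | i != i0) (g i).+1)%N by rewrite dvdn_mulr.
  move: SpG' SpL' dv; set x := (Sp * \sum_(i | _) _)%N => SpG' SpL' dv.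
  have pos1 : ((m + d).+1 - u - ((m + d).+1 - u - x).-1.+1 = x)%N by lia.
  split; first by lia.
  rewrite /Y /W eqxx ifT; last by lia.
  rewrite z_far; last by lia.
  by rewrite pos1 dv.
have Ui_le : (U i <= u)%N by rewrite -U_sum (bigD1 i)//= leq_addr.
have Spg : (Sp * (g i).+1 <= Sp * G)%N by rewrite leq_mul2l ltn_ord orbT.
have Spn : (Sp * G <= Sp * G * nI)%N by rewrite leq_pmulr.
have Spg0 : (0 < Sp * (g i).+1)%N by rewrite muln_gt0.
have dv : (Sp %| Sp * (g i).+1)%N by rewrite dvdn_mulr.
rewrite /gpos (negPf ii0); move: Spg Spg0 dv.
set x := (Sp * (g i).+1)%N => Spg Spg0 dv.
have pos1 : ((U i + x).-1.+1 - U i = x)%N by lia.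
split; first by lia.
rewrite /Y /W (negPf ii0) ifT; last by lia.
rewrite z_near// ?pos1 ?dv; last by lia.
by rewrite ifT//; lia.
Qed.

(** The deficit is multiplied by the number [G ^ nI] of ways to choose the
    branching position among the [G] nonzero digits of each near coordinate. *)
Theorem spaced_corner : exists Y : I -> nat -> nat,
  [/\ forall i j, (Y i j < b)%N,
      forall i, exists2 j, (j < m)%N & Y i j != 0%N
    & #|[pred n | [forall i, lex_below m (X n i) (Y i)]]|%:R
      + (G ^ nI)%:R * (b.-1%:R * b%:R ^- d.+1)
      <= b%:R ^+ m * \prod_i \sum_(j < m) (Y i j)%:R * b%:R ^- j.+1 :> R].
Proof.
have Y_lt i j : (Y i j < b)%N.
  by rewrite /Y; case: ifP => _; rewrite ?(net_digit X_net)// ltnW.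
have b1 : b.-1 != 0%N by case: b b_gt1 => [|[|]].
exists Y; split => //.
  move=> i; have [_ /(_ i)[jm Yj]] := gposE [ffun _ => Ordinal G_gt0].
  by exists (gpos [ffun _ => Ordinal G_gt0] i) => //; rewrite Yj.
(* Near positions are functions on [I] normalized at [i0]. *)
pose F := pffun_on (Ordinal G_gt0) (predC1 i0) [set: 'I_G]%SET.
pose r (g : {ffun I -> 'I_G}) : {ffun I -> 'I_m} :=
  [ffun i => Ordinal ((gposE g).2 i).1].
have r_inj : {in F &, injective r}.
  move=> g g' gF g'F rr; apply/ffunP => i.
  have [->|ii0] := eqVneq i i0.
    have off (h : {ffun I -> 'I_G}) : h \in F -> h i0 = Ordinal G_gt0.
      move=> /pffun_onP[/supportP -> //]; by rewrite !inE eqxx.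
    by rewrite !off.
  have := congr1 (fun h : {ffun I -> 'I_m} => h i : nat) rr.
  rewrite /= !ffunE /= /gpos (negPf ii0) => e.
  have pos k : (0 < Sp * k.+1)%N by rewrite muln_gt0.
  have e' : (Sp * (g i).+1 = Sp * (g' i).+1)%N.
    move: e (pos (g i)) (pos (g' i)).
    by move: (Sp * (g i).+1)%N (Sp * (g' i).+1)%N => x x'; lia.
  by apply/val_inj/succn_inj/eqP; rewrite -(eqn_pmul2l (ltn0Sn (d + t))) -/Sp e'.
have -> : (G ^ nI = #|[set r g | g in F]%SET|)%N.
  rewrite card_in_imset// card_pffun_on card_near; congr (_ ^ _)%N.
  by rewrite cardsT card_ord.
apply: (box_sum R b_gt1 X_net i0 Y_lt Y_z Y_gap) => _ /imsetP[g gF ->].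
have [gs gY] := gposE g; split.
  by rewrite -[RHS]gs; apply: eq_bigr => i _; rewrite ffunE.
by move=> i; rewrite ffunE; have [] := gY i.
Qed.

End SpacedCorner.
(** * Digit rows as functionals on polynomials *)

Section Laurent.
Variable F : fieldType.
Implicit Types (q u y : {poly F}) (L : int -> F) (a : nat -> F).

Lemma laurent_mulp_widen q L n N : (size q <= N)%N ->
  laurent_mulp q L n = \sum_(l < N) q`_l * L (n - (l : nat)%:Z).
Proof.
move=> qN; rewrite /laurent_mulp (big_ord_widen N (fun l => q`_l * L (n - l%:Z)) qN).
rewrite big_mkcond /=; apply: eq_bigr => l _; case: ltnP => // ql.
by rewrite nth_default ?mul0r.
Qed.

Lemma laurent_mulpD q1 q2 L n :
  laurent_mulp (q1 + q2) L n = laurent_mulp q1 L n + laurent_mulp q2 L n.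
Proof.
pose N := maxn (size q1) (size q2).
rewrite !(@laurent_mulp_widen _ _ _ N) ?leq_maxl ?leq_maxr ?size_polyD//.
by rewrite -big_split /=; apply: eq_bigr => l _; rewrite coefD mulrDl.
Qed.

Lemma laurent_mulpZ k q L n :
  laurent_mulp (k *: q) L n = k * laurent_mulp q L n.
Proof.
rewrite (@laurent_mulp_widen _ _ _ (size q)) ?size_scale_leq// mulr_sumr.
by apply: eq_bigr => l _; rewrite coefZ mulrA.
Qed.

Lemma laurent_mulpMX q L n :
  laurent_mulp (q * 'X) L n = laurent_mulp q L (n - 1).
Proof.
rewrite (@laurent_mulp_widen _ _ _ (size q).+1); last first.
  by rewrite (leq_trans (size_polyMleq _ _))// size_polyX addn2.
rewrite big_ord_recl coefMX eqxx mul0r add0r; apply: eq_bigr => l _.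
by rewrite coefMX /= /bump /= add1n; congr (_ * L _); lia.
Qed.

Lemma laurent_mulpA q1 q2 L n :
  laurent_mulp (q1 * q2) L n = laurent_mulp q1 (laurent_mulp q2 L) n.
Proof.
elim/poly_ind: q1 n => [|q1 k IH] n.
  by rewrite mul0r /laurent_mulp size_poly0 !big_ord0.
rewrite mulrDl -mulrA ['X * q2]mulrC mulrA mul_polyC.
rewrite !laurent_mulpD laurent_mulpMX laurent_mulpZ IH laurent_mulpMX.
congr (_ + _); rewrite -[k%:P]alg_polyC laurent_mulpZ.
by rewrite /laurent_mulp size_poly1 big_ord1 coef1 mul1r subr0.
Qed.

Lemma laurent_of_polyM q y n :
  laurent_mulp q (laurent_of_poly y) n = laurent_of_poly (q * y) n.
Proof.
elim/poly_ind: q n => [|q k IH] n.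
  rewrite mul0r /laurent_mulp size_poly0 big_ord0.
  by case: n => // n; rewrite /= coef0.
rewrite laurent_mulpD laurent_mulpMX IH -[k%:P]alg_polyC laurent_mulpZ.
rewrite /laurent_mulp size_poly1 big_ord1 coef1 mul1r subr0.
rewrite mulrDl -mulrA ['X * y]mulrC mulrA alg_polyC mul_polyC.
case: n => [n|n].
  rewrite [RHS]/= coefD coefZ coefMX; congr (_ + _).
  by case: n => [|n] //; have -> : Posz n.+1 - 1 = Posz n by lia.
have -> : Negz n - 1 = Negz n.+1 by lia.
by rewrite /= mulr0 addr0.
Qed.

(** The coefficient of [x^-1] in [u * (\sum_r a r x^(- r - 1))]: in this form a
    row of a generating matrix acts on the digits of an index. *)
Definition residue a u : F := \sum_(r < size u) a r * u`_r.

Lemma residue_widen a u N : (size u <= N)%N ->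
  residue a u = \sum_(r < N) a r * u`_r.
Proof.
move=> uN; rewrite /residue (big_ord_widen N (fun r => a r * u`_r) uN).
rewrite big_mkcond /=; apply: eq_bigr => l _; case: ltnP => // ul.
by rewrite [u`_l]nth_default ?mulr0.
Qed.

Lemma residue_is_scalar a : scalar (residue a).
Proof.
move=> k u v; pose N := maxn (size u) (size v).
rewrite !(@residue_widen _ _ N) ?leq_maxl ?leq_maxr//; last first.
  by rewrite (leq_trans (size_polyD _ _))// geq_max leq_maxr (leq_trans (size_scale_leq _ _))// leq_maxl.
rewrite mulr_sumr -big_split /=; apply: eq_bigr => r _.
by rewrite coefD coefZ mulrDr mulrCA.
Qed.

HB.instance Definition _ a :=
  GRing.isLinear.Build F {poly F} F *%R (residue a) (residue_is_scalar a).

Lemma residueXn a r : residue a 'X^r = a r.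
Proof.
rewrite /residue size_polyXn big_ord_recr /= coefXn eqxx mulr1 big1 ?add0r//.
by move=> i _; rewrite coefXn ltn_eqF ?mulr0.
Qed.

Lemma residue_sum (K : Type) (s : seq K) (P : pred K) (a : K -> nat -> F) u :
  residue (fun r => \sum_(k <- s | P k) a k r) u
  = \sum_(k <- s | P k) residue (a k) u.
Proof.
rewrite /residue exchange_big; apply: eq_bigr => r _ /=.
by rewrite mulr_suml.
Qed.

Lemma residue_lincomb (K : Type) (s : seq K) (P : pred K) (c : K -> F)
    (a : K -> nat -> F) u :
  residue (fun r => \sum_(k <- s | P k) c k * a k r) u
  = \sum_(k <- s | P k) c k * residue (a k) u.
Proof.
rewrite residue_sum; apply: eq_bigr => k _; rewrite /residue mulr_sumr.
by apply: eq_bigr => r _; rewrite mulrA.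
Qed.

Definition annihilates q a : Prop := forall u, residue a (q * u) = 0.

Lemma annihilates_dvdp q q' a : q %| q' -> annihilates q a -> annihilates q' a.
Proof. by move=> /dvdpP[h ->] qa u; rewrite mulrAC mulrC qa. Qed.

Lemma residue_mulXn q a k :
  residue a (q * 'X^k) = laurent_mulp q (laurent_of_tail a) (Negz k).
Proof.
rewrite (@residue_widen _ _ (k + size q)); last first.
  by rewrite (leq_trans (size_polyMleq _ _))// size_polyXn addnS addnC.
rewrite big_split_ord /= big1 ?add0r => [|i _]; last first.
  by rewrite coefMXn ltn_ord mulr0.
apply: eq_bigr => l _; rewrite coefMXn ltnNge leq_addr /= addKn mulrC.
by have -> : Negz k - (l : nat)%:Z = Negz (k + l) by lia.
Qed.

Lemma annihilatesP q a :
  annihilates q a <-> forall k, laurent_mulp q (laurent_of_tail a) (Negz k) = 0.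
Proof.
split=> [qa k|qa u]; first by rewrite -residue_mulXn qa.
rewrite -[u]coefK poly_def mulr_sumr linear_sum big1 // => k _.
by rewrite -scalerAr linearZ /= residue_mulXn qa mulr0.
Qed.

Lemma expansion_annihilates y q a : expansion y q a -> annihilates q a.
Proof. by move=> ya; apply/annihilatesP => k; rewrite ya. Qed.

Lemma expansion_sum n q (c : nat -> F) (y : nat -> {poly F})
    (a : nat -> nat -> F) :
  (forall k, (k < n)%N -> expansion (y k) q (a k)) ->
  expansion (\sum_(k < n) c k *: y k) q (fun r => \sum_(k < n) c k * a k r).
Proof.
move=> ya z; transitivity (\sum_(k < n) c k * laurent_of_poly (y k) z).
  under [RHS]eq_bigr => k _ do rewrite -(ya k (ltn_ord k) z).
  rewrite /laurent_mulp; under [RHS]eq_bigr do rewrite mulr_sumr.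
  rewrite exchange_big; apply: eq_bigr => l _ /=.
  rewrite /laurent_of_tail; case: (z - _) => r.
    by rewrite mulr0 big1 // => k _; rewrite !mulr0.
  by rewrite mulr_sumr; apply: eq_bigr => k _; rewrite mulrCA.
case: z => r /=; last by rewrite big1 // => k _; rewrite mulr0.
by rewrite coef_sum; apply: eq_bigr => k _; rewrite coefZ.
Qed.

Lemma laurent_mulp_tail_small q a n : (size q <= n)%N ->
  laurent_mulp q (laurent_of_tail a) (Posz n) = 0.
Proof.
move=> qn; rewrite /laurent_mulp big1 // => l _.
have ln := leq_trans (ltn_ord l) qn.
have -> : Posz n - (l : nat)%:Z = Posz (n - l) by lia.
by rewrite mulr0.
Qed.

Lemma expansion_size y q a : expansion y q a -> (size y <= size q)%N.
Proof.
by move=> ya; apply/leq_sizeP => n qn; rewrite -[RHS](laurent_mulp_tail_small a qn) ya.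
Qed.

(** If the denominator [p * q] of [y / (p * q)] can be lowered to [q], then [y] is
    divisible by [p]: multiplying the series by [q] gives a polynomial [y'] with
    [y = p * y']. *)
Lemma expansion_dvdp y p q a :
  expansion y (p * q) a -> annihilates q a -> p %| y.
Proof.
move=> ya /annihilatesP qa.
pose y' := \poly_(n < size q) laurent_mulp q (laurent_of_tail a) (Posz n).
have qE n : laurent_mulp q (laurent_of_tail a) n = laurent_of_poly y' n.
  case: n => [n|n]; last by rewrite qa.
  rewrite /= coef_poly; case: ltnP => // /laurent_mulp_tail_small -> //.
suff -> : y = p * y' by rewrite dvdp_mulr.
apply/polyP => n; rewrite -[LHS]/(laurent_of_poly y (Posz n)) -ya laurent_mulpA.
rewrite -[RHS]/(laurent_of_poly (p * y') (Posz n)) -laurent_of_polyM.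
by apply: eq_bigr => l _; rewrite qE.
Qed.

(** The expansion of [y / q] starts at [x^(deg y - deg q)]. *)
Lemma expansion_small y q a r : expansion y q a ->
  ((pdeg y + r).+1 < pdeg q)%N -> a r = 0.
Proof.
move=> ya; elim/ltn_ind: r => r IH hr.
have q0 : q != 0 by apply: contraTneq hr => ->; rewrite /pdeg size_poly0.
have := ya (Posz ((pdeg q).-1 - r)).
rewrite /= [RHS]nth_default; last first.
  by move: hr; rewrite /pdeg; move: (size y) (size q) => k l; lia.
have sq : size q = (pdeg q).+1 by rewrite /pdeg prednK// size_poly_gt0.
rewrite /laurent_mulp sq big_ord_recr big1 /= ?add0r => [|l _].
  have -> : Posz ((pdeg q).-1 - r) - (pdeg q)%:Z = Negz r by lia.
  by move/eqP; rewrite mulf_eq0 -/(lead_coef q) lead_coef_eq0 (negPf q0) => /eqP.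
have ll := ltn_ord l; rewrite /laurent_of_tail.
case E : (_ - _) => [k|k]; rewrite ?mulr0// IH ?mulr0//; lia.
Qed.

Lemma annihilates_coprime (A B : {poly F}) a : coprimep A B ->
  annihilates A a -> annihilates B a -> forall r, a r = 0.
Proof.
move=> /Bezout_eq1_coprimepP[[h k] /= hk] aA aB r.
rewrite -residueXn -[X in residue a X]mul1r -hk mulrDl linearD /=.
by rewrite ![_ * A]mulrC ![_ * B]mulrC -!mulrA aA aB addr0.
Qed.

(** Modulo [q], every multiple of ['X^w] is a combination of
    ['X^w, ..., 'X^(w + deg q - 1)].  So the zeros on this window make ['X^w]
    annihilate the sequence; then so does [gcdp 'X^w q], and with it ['X^V]. *)
Lemma annihilates_window q a (w V : nat) : q != 0 -> annihilates q a ->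
  gcdp 'X^w q %| 'X^V ->
  (forall r, (r < V)%N -> a r = 0) ->
  (forall r, (w <= r < w + pdeg q)%N -> a r = 0) ->
  forall r, a r = 0.
Proof.
move=> q0 qa gV aV aw.
have wa : annihilates 'X^w a.
  move=> u; rewrite {1}(divp_eq u q) mulrDr linearD /= [_ * q]mulrC mulrCA qa add0r.
  have := ltn_modp u q; rewrite q0; set v := (u %% q)%R => vq.
  rewrite -[v]coefK poly_def mulr_sumr linear_sum big1 // => k _ /=.
  rewrite -scalerAr -exprD linearZ /= residueXn aw ?mulr0//.
  by rewrite leq_addr ltn_add2l (leq_trans (ltn_ord k))// -ltnS (ltn_predK vq).
have Va : annihilates 'X^V a.
  have [[h k] /=] := Bezoutp 'X^w q.
  move=> /eqp_dvdl gE; move: gV; rewrite -gE => /dvdpP[g ->] u.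
  have -> : g * (h * 'X^w + k * q) * u = 'X^w * (g * h * u) + q * (g * k * u).
    by ring.
  by rewrite linearD /= wa qa addr0.
move=> r; have [|Vr] := ltnP r V; first exact: aV.
by rewrite -residueXn -(subnKC Vr) exprD Va.
Qed.

End Laurent.
(** * Counting solutions of linear systems *)

Section Solutions.
Variable F : finFieldType.

(** A row-free matrix gives a surjective map whose fibers are translates of each
    other. *)
Lemma card_fiber_mulmx (k m : nat) (A : 'M[F]_(k, m)) (v : 'rV_k) :
  row_free A ->
  (#|[pred u : 'rV_m | u *m A^T == v]| * #|F| ^ k = #|F| ^ m)%N.
Proof.
case/row_freeP => B AB.
have fib w : #|[pred u : 'rV_m | u *m A^T == w]| =
    #|[pred u : 'rV_m | u *m A^T == v]|.
  have BK (x : 'rV_k) : (x *m B^T) *m A^T = x.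
    by rewrite -mulmxA -trmx_mul AB trmx1 mulmx1.
  rewrite -!sum1_card (reindex_inj (addrI ((w - v) *m B^T))) /=.
  apply: eq_bigl => u; rewrite !inE [(_ + u) *m _]mulmxDl BK -[LHS]subr_eq0 -[RHS]subr_eq0.
  by rewrite addrAC [w - v]addrC addrK addrC.
have := card_mx F 1 m; rewrite mul1n => <-.
rewrite -[RHS]sum1_card (partition_big (fun u : 'rV_m => u *m A^T) predT)//=.
rewrite (eq_bigr (fun=> #|[pred u : 'rV_m | u *m A^T == v]|)); last first.
  by move=> w _; rewrite -(fib w) -sum1_card; apply: eq_bigl => u; rewrite !inE.
by rewrite sum_nat_const card_mx mul1n mulnC.
Qed.

Lemma card_solutions (K : finType) (P : pred K) (L : K -> nat -> F) (m : nat)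
    (v : K -> F) :
  (forall c : K -> F, (forall k, ~~ P k -> c k = 0) ->
     (forall r, (r < m)%N -> \sum_k c k * L k r = 0) -> forall k, c k = 0) ->
  #|[pred u : 'rV[F]_m |
      [forall (k | P k), \sum_(r < m) L k r * u 0 r == v k]]|
  = (#|F| ^ (m - #|P|))%N.
Proof.
move=> indep; pose A := \matrix_(k < #|P|, r < m) L (enum_val k) r.
have enumP (k : 'I_#|P|) : P (enum_val k) by apply: enum_valP.
have Afree : row_free A.
  apply: inj_row_free => w wA; apply/rowP => k0.
  pose c k := if [pick j : 'I_#|P| | enum_val j == k] is Some j then w 0 j else 0.
  have cE k : c (enum_val k) = w 0 k.
    rewrite /c; case: pickP => [j /eqP/enum_val_inj -> //|/(_ k)].
    by rewrite eqxx.
  have cN k : ~~ P k -> c k = 0.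
    by rewrite /c; case: pickP => // j /eqP <-; rewrite enumP.
  rewrite [RHS]mxE -cE; apply: indep => // r rm.
  have /rowP/(_ (Ordinal rm)) := wA; rewrite !mxE => wAr.
  rewrite -[RHS]wAr (bigID P) /= addrC big1 ?add0r => [|k /cN->]; last by rewrite mul0r.
  rewrite (eq_bigl (fun k => k \in P)) // big_enum_val /=.
  apply: eq_bigr => k _.
  by rewrite cE mxE.
have := card_fiber_mulmx (\row_k v (enum_val k)) Afree.
have Pm : (#|P| <= m)%N by rewrite -[X in (X <= _)%N](eqP Afree) rank_leq_col.
have -> : (#|F| ^ m = #|F| ^ (m - #|P|) * #|F| ^ #|P|)%N.
  by rewrite -expnD subnK.
move=> /eqP; rewrite eqn_pmul2r; last first.
  by rewrite expn_gt0 ltnW ?card_finNzRing_gt1.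
move=> /eqP <-; apply: eq_card => u; rewrite !inE.
apply/forall_inP/eqP => [h|h k Pk].
  apply/rowP => k; rewrite !mxE -(eqP (h _ (enumP k))).
  by apply: eq_bigr => r _; rewrite !mxE mulrC.
have := congr1 (fun w : 'rV_#|P| => w 0 (enum_rank_in Pk k)) h.
rewrite !mxE enum_rankK_in// => <-.
by apply/eqP/eq_bigr => r _; rewrite !mxE enum_rankK_in// mulrC.
Qed.

End Solutions.
(** * Independence of the Niederreiter rows *)

Lemma sum_widen (V : nmodType) (f : nat -> V) (n n' : nat) :
  (forall j, (n <= j)%N -> f j = 0) -> (forall j, (n' <= j)%N -> f j = 0) ->
  \sum_(j < n) f j = \sum_(j < n') f j.
Proof.
wlog nn' : n n' / (n <= n')%N => [hw|] fn fn'.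
  by case: (leqP n n') => [|/ltnW] h; [|apply/esym]; apply: hw.
rewrite (big_ord_widen n' f nn') big_mkcond /=; apply: eq_bigr => j _.
by case: ltnP => // /fn.
Qed.

Lemma ceil_mul (n k : nat) : (0 < k)%N ->
  (n <= (n + k.-1) %/ k * k < n + k)%N.
Proof.
move=> k0; have := ltn_ceil (n + k.-1) k0; have := leq_divM (n + k.-1) k.
by rewrite mulSn; lia.
Qed.

Section Rows.
Variables (F : fieldType) (s : nat) (p : 'I_s -> {poly F}).
Hypothesis p_deg : forall i, (1 <= pdeg (p i))%N.
Hypothesis p_coprime : forall i i', i != i' -> coprimep (p i) (p i').
Variable y : 'I_s -> nat -> nat -> {poly F}.
Hypothesis y_indep : forall (i : 'I_s) (j : nat), (1 <= j)%N ->
  lin_indep_mod (p i) (pdeg (p i)) (y i j).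
Variable a : 'I_s -> nat -> nat -> nat -> F.
Hypothesis a_expansion : forall (i : 'I_s) (j k : nat), (1 <= j)%N ->
  (k < pdeg (p i))%N -> expansion (y i j k) (p i ^+ j) (a i j k).

Let e i := pdeg (p i).
Let row i := niederreiter_matrix (e i) (a i).

Lemma pfactor_neq0 i : p i != 0.
Proof. by apply: contraTneq (p_deg i) => ->; rewrite /pdeg size_poly0. Qed.

Lemma row_annihilates i q j : (j < q * e i)%N -> annihilates (p i ^+ q) (row i j).
Proof.
move=> jq; have jQ : (j %/ e i < q)%N by rewrite ltn_divLR ?p_deg.
apply: annihilates_dvdp (dvdp_exp2l (p i) jQ) _.
exact: expansion_annihilates (a_expansion (ltn0Sn _) (ltn_pmod _ (p_deg i))).
Qed.

Lemma rows_annihilates i q (c : nat -> F) :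
  annihilates (p i ^+ q) (fun r => \sum_(j < q * e i) c j * row i j r).
Proof.
move=> u; rewrite residue_lincomb big1 // => j _.
by rewrite (row_annihilates (ltn_ord j)) mulr0.
Qed.

(** Only the block of rows with exponent [q + 1] fails to be annihilated by
    [p i ^+ q].  If a combination vanishes, then its top block is annihilated by
    [p i ^+ q] as well, so [p i] divides the combination of the [y i q.+1 k] by
    [expansion_dvdp], and the hypothesis on the [y] kills that block. *)
Lemma rows_free_one i q (c : nat -> F) :
  (forall r, \sum_(j < q * e i) c j * row i j r = 0) ->
  forall j, (j < q * e i)%N -> c j = 0.
Proof.
elim: q => [|q IH] c0 j; first by rewrite mul0n.
pose top r := \sum_(k < e i) c (q * e i + k)%N * a i q.+1 k r.
have topE r : \sum_(j < q * e i) c j * row i j r + top r = 0.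
  rewrite -[RHS](c0 r) mulSnr big_split_ord /=; congr (_ + _).
  apply: eq_bigr => k _; rewrite /row /niederreiter_matrix.
  by rewrite divnMDl ?p_deg// modnMDl divn_small ?modn_small ?addn0.
have top_p : annihilates (p i ^+ q) top.
  move=> u; have := @rows_annihilates i q c u; rewrite /residue => rows0.
  apply/eqP; rewrite -oppr_eq0 -[X in _ == X]rows0 -sumrN; apply/eqP.
  by apply: eq_bigr => r _; rewrite -mulNr; congr (_ * _); apply/esym/eqP;
    rewrite -addr_eq0 topE.
have c_top k : (k < e i)%N -> c (q * e i + k)%N = 0.
  move=> ke; have y_exp : expansion (\sum_(k < e i) c (q * e i + k)%N *: y i q.+1 k)
      (p i * p i ^+ q) top.
    rewrite -exprS; apply: (expansion_sum (fun k => c (q * e i + k)%N)).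
    by move=> l le; apply: a_expansion.
  have := @y_indep i q.+1 (ltn0Sn q) (fun k => c (q * e i + k)%N).
  by move=> /(_ (expansion_dvdp y_exp top_p) (Ordinal ke)).
have [jq _|qj] := ltnP j (q * e i).
  apply: IH jq => r; rewrite -[RHS](topE r) -[LHS]addr0; congr (_ + _).
  by rewrite /top big1 // => k _; rewrite c_top ?mul0r.
by rewrite mulSnr -{1 2}(subnKC qj) ltn_add2l => /c_top.
Qed.

Definition modulus (q : 'I_s -> nat) : {poly F} := \prod_i p i ^+ q i.

Lemma modulus_neq0 q : modulus q != 0.
Proof. by apply/prodf_neq0 => i _; rewrite expf_neq0// pfactor_neq0. Qed.

Lemma pdeg_modulus q : pdeg (modulus q) = (\sum_i q i * e i)%N.
Proof.
rewrite /pdeg size_prod => [|i _]; last by rewrite expf_neq0// pfactor_neq0.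
have sz i : size (p i ^+ q i) = (q i * e i).+1.
  rewrite -[LHS]prednK ?size_poly_gt0 ?expf_neq0 ?pfactor_neq0//.
  by rewrite size_exp mulnC.
under eq_bigr do rewrite sz -addn1.
rewrite big_split /= sum_nat_const muln1 card_ord.
lia.
Qed.

Lemma modulus_annihilates q (c : 'I_s -> nat -> F) :
  annihilates (modulus q)
    (fun r => \sum_i \sum_(j < q i * e i) c i j * row i j r).
Proof.
move=> u; rewrite residue_sum big1 // => i _.
by rewrite /modulus (bigD1 i)//= -mulrA rows_annihilates.
Qed.

(** The part of a vanishing combination that belongs to [i] is annihilated by
    [p i ^+ q i], and also by the product of the other moduli since this product
    annihilates all other parts; these two polynomials are coprime. *)
Lemma rows_free (q : 'I_s -> nat) (c : 'I_s -> nat -> F) :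
  (forall r, \sum_i \sum_(j < q i * e i) c i j * row i j r = 0) ->
  forall i j, (j < q i * e i)%N -> c i j = 0.
Proof.
move=> c0 i; apply: rows_free_one.
pose cofactor := \prod_(i' | i' != i) p i' ^+ q i'.
have co : coprimep (p i ^+ q i) cofactor.
  apply: (big_ind (coprimep (p i ^+ q i))) => [|u v|i' ii'].
  - exact: coprimep1.
  - by rewrite coprimepMr => -> ->.
  - by apply: coprimep_expl; apply: coprimep_expr; rewrite p_coprime// eq_sym.
apply: (annihilates_coprime co (@rows_annihilates i (q i) (c i))) => u.
have : residue (fun r => \sum_i \sum_(j < q i * e i) c i j * row i j r)
    (cofactor * u) = 0.
  rewrite /residue big1 // => r _.
  by rewrite c0 mul0r.
rewrite residue_sum (bigD1 i)//= [X in _ + X]big1 ?addr0// => i' ii'.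
by rewrite /cofactor (bigD1 i')//= -mulrA rows_annihilates.
Qed.

(** The condition on the gcd is void for [w = 0].  For [w > 0] it asks that the
    power of ['X] in the moduli be at most ['X^V]: such a factor produces rows
    supported on the first columns, invisible to a window further up. *)
Lemma rows_window (q : 'I_s -> nat) (c : 'I_s -> nat -> F) (w V B : nat) :
  gcdp 'X^w (modulus q) %| 'X^V ->
  (forall i j, (minn (q i * e i) B <= j)%N -> c i j = 0) ->
  (forall r, (r < V)%N || (w <= r < w + \sum_i q i * e i)%N ->
     \sum_i \sum_(j < B) c i j * row i j r = 0) ->
  forall i j, c i j = 0.
Proof.
move=> gV c_supp c0 i j.
have [qj|jq] := leqP (q i * e i) j; first by rewrite c_supp// geq_min qj.
move: i j jq; apply: rows_free.
have rowsE r : \sum_i \sum_(j < q i * e i) c i j * row i j r =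
    \sum_i \sum_(j < B) c i j * row i j r.
  apply: eq_bigr => i _; apply: (sum_widen (f := fun j => c i j * row i j r)) => j hj;
    by rewrite c_supp ?mul0r// geq_min hj ?orbT.
apply: (annihilates_window (modulus_neq0 q) (modulus_annihilates q c) gV) => r hr.
  by rewrite rowsE c0// hr.
by rewrite rowsE c0// -pdeg_modulus hr orbT.
Qed.

End Rows.
(** * Shifted digital point sets are admissible nets *)

Lemma big_option (R : Type) (idx : R) (op : Monoid.com_law idx) (I : finType)
    (f : option I -> R) :
  \big[op/idx]_i f i = op (f None) (\big[op/idx]_i f (Some i)).
Proof.
rewrite (bigD1 None) //= (reindex_omap Some id) => [|[i|]//]; congr (op _ _).
by apply: eq_bigl => i; rewrite eqxx.
Qed.

Lemma card_pairs_below (I : finType) (f : I -> nat) (B : nat) :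
  (forall i, (f i <= B)%N) ->
  #|[pred k : I * 'I_B | (k.2 < f k.1)%N]| = (\sum_i f i)%N.
Proof.
move=> fB; rewrite -sum1_card big_mkcond /=.
rewrite -(pair_bigA _ (fun i (j : 'I_B) =>
  if (i, j) \in [pred k : I * 'I_B | (k.2 < f k.1)%N] then 1%N else 0%N)) /=.
apply: eq_bigr => i _; rewrite -big_mkcond /= -[RHS]card_ord -sum1_card.
by rewrite (big_ord_widen B (fun=> 1%N) (fB i)).
Qed.

Section DigitalNet.
Variables (F : finFieldType) (s : nat).
Variables (phi : 'I_#|F| -> F) (phi_inv : F -> 'I_#|F|).
Hypothesis phiK : cancel phi phi_inv.
Hypothesis phi_invK : cancel phi_inv phi.
Variable p : 'I_s -> {poly F}.
Hypothesis p_deg : forall i, (1 <= pdeg (p i))%N.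
Hypothesis p_coprime : forall i i', i != i' -> coprimep (p i) (p i').
Variable y : 'I_s -> nat -> nat -> {poly F}.
Hypothesis y_indep : forall (i : 'I_s) (j : nat), (1 <= j)%N ->
  lin_indep_mod (p i) (pdeg (p i)) (y i j).
Variable a : 'I_s -> nat -> nat -> nat -> F.
Hypothesis a_expansion : forall (i : 'I_s) (j k : nat), (1 <= j)%N ->
  (k < pdeg (p i))%N -> expansion (y i j k) (p i ^+ j) (a i j k).

Let b := #|F|.
Let e i := pdeg (p i).
Let row i := niederreiter_matrix (e i) (a i).
Let e0 := (\sum_i e i)%N.
Let t := (e0 - s)%N.

Let b_gt0 : (0 < b)%N.
Proof. exact: ltnW (card_finNzRing_gt1 F). Qed.

Let s_le_e0 : (s <= e0)%N.
Proof.
rewrite -[X in (X <= _)%N]card_ord -sum1_card; apply: leq_sum => i _.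
exact: p_deg.
Qed.

(** This is admissibility in polynomial form.  With [q i] the number of complete
    blocks of [e i] rows below [r i], the [D = \sum_i q i * e i] functionals are
    independent on the [D]-dimensional space of remainders modulo the product of
    the [p i ^+ q i], so their only common zero there is 0: the product divides
    [u].  The incomplete blocks account for the term [e0]. *)
Lemma common_zeros (u : {poly F}) (r : 'I_s -> nat) : u != 0 ->
  (forall i j, (j < r i)%N -> residue (row i j) u = 0) ->
  (\sum_i (r i).+1 <= pdeg u + e0)%N.
Proof.
move=> u0 ru; pose q i := (r i %/ e i)%N; pose P := modulus p q.
have P0 : P != 0 := modulus_neq0 p_deg q.
have degP : pdeg P = (\sum_i q i * e i)%N := pdeg_modulus p_deg q.
suff P_u : P %| u.
  have Pu : (pdeg P <= pdeg u)%N.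
    by have := dvdp_leq u0 P_u; rewrite /pdeg; case: (size P) (size u) => [|k] [|l].
  apply: (@leq_trans (\sum_i (q i * e i + e i))); last first.
    by rewrite big_split /= leq_add2r -degP.
  by apply: leq_sum => i _; rewrite -mulSnr; apply: ltn_ceil (p_deg i).
pose D := pdeg P; pose v := (u %% P)%R.
have vD : (size v <= D)%N by rewrite -ltnS /D /pdeg prednK ?size_poly_gt0// ltn_modp.
have rv i j : (j < q i * e i)%N -> residue (row i j) v = 0.
  move=> jq; have := ru i j (leq_trans jq (leq_divM _ _)).
  rewrite {1}(divp_eq u P) linearD /= mulrC.
  by rewrite (annihilates_dvdp _ (row_annihilates p_deg a_expansion jq)) ?add0r//
    /P /modulus (bigD1 i)//= dvdp_mulr.
have qD i : (q i * e i <= D)%N by rewrite /D degP (bigD1 i)//= leq_addr.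
pose L (k : 'I_s * 'I_D) r := row k.1 k.2 r.
pose K := [pred k : 'I_s * 'I_D | (k.2 < q k.1 * e k.1)%N].
have L_free (c : 'I_s * 'I_D -> F) : (forall k, ~~ K k -> c k = 0) ->
    (forall r, (r < D)%N -> \sum_k c k * L k r = 0) -> forall k, c k = 0.
  move=> cN c0 [i j]; pose c' i j := if insub j is Some j' then c (i, j') else 0.
  have c'E (i' : 'I_s) (j' : 'I_D) : c' i' j' = c (i', j') by rewrite /c' valK.
  rewrite -c'E; move: i (j : nat) => {j}.
  apply: (rows_window p_deg p_coprime y_indep a_expansion (q := q)
            (w := 0) (V := 0) (B := D)); first by rewrite dvdp_gcdl.
    move=> i j hj; rewrite /c'; case: insubP => // j' _ jj'; apply: cN.
    by move: hj; rewrite geq_min -jj' leqNgt (leqNgt D) ltn_ord orbF.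
  move=> l; rewrite ltn0 add0n -degP => /= lD; rewrite -[RHS](c0 l lD).
  rewrite (pair_bigA _ (fun i (j : 'I_D) => c' i j * row i j l)) /=.
  by apply: eq_bigr => -[i j] _; rewrite c'E.
have := card_solutions (fun=> 0) L_free.
rewrite (card_pairs_below qD) -degP subnn expn0 => /eq_leq/card_le1_eqP card1.
have sol0 : (0 : 'rV[F]_D) \in [pred u : 'rV[F]_D |
   [forall (k | K k), \sum_(r < D) L k r * u 0 r == 0]].
  by rewrite inE; apply/forall_inP => k _; rewrite big1 // => l _; rewrite mxE mulr0.
have solv : (poly_rV v : 'rV[F]_D) \in [pred u : 'rV[F]_D |
   [forall (k | K k), \sum_(r < D) L k r * u 0 r == 0]].
  rewrite inE; apply/forall_inP => -[i j] /= /rv; rewrite (residue_widen _ vD) => rv0.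
  by rewrite -[X in _ == X]rv0; apply/eqP/eq_bigr => l _; rewrite mxE.
have /(congr1 rVpoly) := card1 _ _ solv sol0.
by rewrite poly_rV_K// linear0 => v0; apply/modp_eq0P.
Qed.

Variables (m : nat) (shift : option 'I_s -> nat -> nat).

(** The coordinate [None] reads the digits of the index from the most
    significant one, so that the [s + 1] coordinates form the Hammersley-type
    net of the points [(x_n, n / b ^ m)]. *)
Definition coord_row (i : option 'I_s) (j r : nat) : F :=
  if i is Some i' then row i' j r else (r + j.+1 == m)%:R.

Definition coord_digit (u : 'rV[F]_m) (i : option 'I_s) (j : nat) : nat :=
  ((phi_inv (\sum_(r < m) coord_row i j r * u 0 r)%R + shift i j) %% b)%N.

(* The field element that the shift carries to the digit [c]. *)
Let unshift (i : option 'I_s) (j c : nat) : F :=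
  phi (Ordinal (ltn_pmod (c + (b - shift i j %% b)) b_gt0)).

Let unshiftP i j (f : F) c : (c < b)%N ->
  ((phi_inv f + shift i j) %% b == c)%N = (f == unshift i j c).
Proof.
move=> cb; rewrite /unshift -(can_eq phi_invK) phiK.
have wb : (shift i j %% b <= b)%N by rewrite ltnW ?ltn_pmod.
apply/eqP/eqP => [<-|->] /=; last first.
  by rewrite modnDml -modnDmr -addnA subnK// modnDr modn_small.
apply: val_inj; rewrite /= -[LHS](modn_small (ltn_ord _)).
by rewrite modnDml -addnA -modnDmr -(modnDml (shift i j)) subnKC// modnn addn0.
Qed.

(** The rows of the coordinate [None] are unit vectors, so they only matter through
    the columns that they occupy; on the remaining columns the rows of the
    sequence must be independent by themselves. *)
Lemma coord_rows_free (q : 'I_s -> nat) (w V : nat) (c : option 'I_s -> nat -> F) :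
  gcdp 'X^w (modulus p q) %| 'X^V -> (V <= m)%N ->
  (w + \sum_i q i * e i <= m)%N ->
  (forall i j, (minn (q i * e i) m <= j)%N -> c (Some i) j = 0) ->
  (forall r, (r < V)%N || (w <= r < w + \sum_i q i * e i)%N ->
     c None (m - r.+1)%N = 0) ->
  (forall r, (r < m)%N -> \sum_i \sum_(j < m) c i j * coord_row i j r = 0) ->
  forall i j, (j < m)%N -> c i j = 0.
Proof.
move=> gV Vm wm c_supp cN c0.
have noneE r : (r < m)%N ->
    \sum_(j < m) c None j * coord_row None j r = c None (m - r.+1)%N.
  move=> rm; have jm : (m - r.+1 < m)%N by lia.
  rewrite (bigD1 (Ordinal jm)) //= big1 ?addr0 => [|j jN].
    have -> : (r + (m - r.+1).+1 == m)%N by lia.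
    by rewrite mulr1.
  case: eqP => [rj|_]; last by rewrite mulr0.
  by case/eqP: jN; apply: val_inj => /=; lia.
have cS i j : c (Some i) j = 0.
  move: i j; apply: (rows_window p_deg p_coprime y_indep a_expansion gV c_supp).
  move=> r hr; have rm : (r < m)%N.
    by case/orP: hr => [/leq_trans|/andP[_ /leq_trans]]; apply.
  by have := c0 r rm; rewrite big_option /= noneE// cN// add0r.
move=> [i|] j jm //.
have rm : (m - j.+1 < m)%N by lia.
have := c0 _ rm; rewrite big_option /= noneE// big1 ?addr0 => [|i _]; last first.
  by rewrite big1 // => j' _; rewrite cS mul0r.
by have -> : (m - (m - j.+1).+1 = j)%N by lia.
Qed.

Section Prescribed.
Variable P : pred (option 'I_s * 'I_m).
Hypothesis P_free : forall c : option 'I_s -> nat -> F,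
  (forall i (j : 'I_m), ~~ P (i, j) -> c i j = 0) ->
  (forall i j, (m <= j)%N -> c i j = 0) ->
  (forall r, (r < m)%N -> \sum_i \sum_(j < m) c i j * coord_row i j r = 0) ->
  forall i j, (j < m)%N -> c i j = 0.

Lemma card_prescribed (v : option 'I_s -> nat -> nat) :
  (forall i j, (v i j < b)%N) ->
  #|[pred u | [forall (k | P k), coord_digit u k.1 k.2 == v k.1 k.2]]|
  = (b ^ (m - #|P|))%N.
Proof.
move=> vb.
rewrite -(@card_solutions F (option 'I_s * 'I_m)%type P
  (fun k r => coord_row k.1 k.2 r) m (fun k => unshift k.1 k.2 (v k.1 k.2))).
  apply: eq_card => u; rewrite !inE; apply: eq_forallb => k.
  by rewrite /coord_digit unshiftP.
move=> c cN c0 [i j].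
pose c' i j := if insub j is Some j' then c (i, j') else 0.
have c'E (i' : option 'I_s) (j' : 'I_m) : c' i' j' = c (i', j') by rewrite /c' valK.
rewrite -c'E; apply: P_free => //.
- by move=> i' j' /cN; rewrite c'E.
- by move=> i' j' mj; rewrite /c' insubN// -leqNgt.
move=> r rm; rewrite -[RHS](c0 r rm).
rewrite (pair_bigA _ (fun i (j : 'I_m) => c' i j * coord_row i j r)) /=.
by apply: eq_bigr => -[i' j'] _; rewrite c'E.
Qed.

Lemma prescribed_point (v : option 'I_s -> nat -> nat) :
  (forall i j, (v i j < b)%N) ->
  exists u, forall i (j : 'I_m), P (i, j) -> coord_digit u i j = v i j.
Proof.
move=> vb; have /card_gt0P[u] :
    (0 < #|[pred u | [forall (k | P k), coord_digit u k.1 k.2 == v k.1 k.2]]|)%N.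
  by rewrite card_prescribed// expn_gt0 b_gt0.
rewrite inE => /forall_inP hu; exists u => i j Pij.
by apply/eqP/(hu (i, j)).
Qed.

End Prescribed.

(** Rounding [r i] up to a multiple of [e i] costs at most [e i - 1] in each
    direction, and these losses add up to [t]. *)
Lemma digital_admissible_net : admissible_net b m e0 t coord_digit.
Proof.
split.
- by move=> u i j; rewrite ltn_pmod.
- move=> r c cb rm.
  have r_le i : (r i <= m)%N.
    by apply: leq_trans rm; rewrite (bigD1 i)//= -addnA leq_addr.
  rewrite -(card_pairs_below r_le) -(card_prescribed _ cb) => [|c' c'N c'm c'0].
    apply: subset_leq_card; apply/fintype.subsetP => u; rewrite !inE => /forallP hu.
    by apply/forall_inP => -[i j] /= jr; have /agreeP/(_ j jr)/eqP := hu i.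
  pose q i := ((r (Some i) + (e i).-1) %/ e i)%N.
  have q_ge i : (r (Some i) <= q i * e i)%N.
    by have /andP[] := ceil_mul (r (Some i)) (p_deg i).
  have q_le : (\sum_i q i * e i + r None <= m)%N.
    apply: leq_trans rm; rewrite big_option /=.
    have : (\sum_i q i * e i + s <= \sum_i r (Some i) + e0)%N.
      rewrite -[X in (_ + X <= _)%N](card_ord s) -sum1_card -!big_split /=.
      apply: leq_sum => i _; rewrite addn1.
      by have /andP[] := ceil_mul (r (Some i)) (p_deg i).
    by move=> h; rewrite addnC -addnA leq_add2l -(leq_add2r s) -addnA subnK.
  apply: (coord_rows_free (q := q) (w := 0) (V := 0)) => //.
  + by rewrite dvdp_gcdl.
  + lia.
  + move=> i j; rewrite geq_min => /orP[qj|/c'm//].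
    have [jm|/c'm//] := ltnP j m.
    by apply: (c'N (Some i) (Ordinal jm)); rewrite inE /= -leqNgt (leq_trans (q_ge i)).
  + move=> k; rewrite ltn0 add0n /= => kq.
    have kr : (k + r None < m)%N.
      by apply: leq_trans q_le; rewrite -addSn leq_add2r.
    have km : (k < m)%N := leq_ltn_trans (leq_addr _ _) kr.
    have jm : (m - k.+1 < m)%N by lia.
    by apply: (c'N None (Ordinal jm)); rewrite inE /= -leqNgt leq_subRL.
move=> u u' r uu' agr; pose f := u - u'.
have f0 : f != 0 by rewrite subr_eq0.
have f_row i j : (j < r i)%N -> \sum_(k < m) coord_row i j k * f 0 k = 0.
  move=> jr; have /agreeP/(_ j jr)/eqP := agr i.
  rewrite /coord_digit unshiftP ?ltn_pmod//.
  have := unshiftP i j (\sum_(k < m) coord_row i j k * u' 0 k)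
    (ltn_pmod (phi_inv (\sum_(k < m) coord_row i j k * u' 0 k) + shift i j) b_gt0).
  rewrite eqxx => /esym/eqP <- /eqP /esym/eqP; rewrite eq_sym -subr_eq0 -sumrB => /eqP f_sum.
  by rewrite -[RHS]f_sum; apply: eq_bigr => k _; rewrite !mxE mulrBr.
pose w := rVpoly f.
have w_size : (size w <= m)%N by apply: size_poly.
have w0 : w != 0 by rewrite -(inj_eq (can_inj (@rVpolyK F m))) linear0 in f0 *.
have wE (k : 'I_m) : w`_k = f 0 k by rewrite coef_rVpoly_ord.
have wdeg : (pdeg w < m)%N by rewrite /pdeg prednK ?size_poly_gt0.
have := @common_zeros w (fun i => r (Some i)) w0.
have rowE i j : residue (row i j) w = \sum_(k < m) coord_row (Some i) j k * f 0 k.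
  by rewrite (residue_widen _ w_size); apply: eq_bigr => k _; rewrite wE.
move=> /(_ (fun i j jr => etrans (rowE i j) (f_row (Some i) j jr))) bound.
rewrite big_option /=.
suff r_le : (r None <= m - (pdeg w).+1)%N.
  have r_lt : (r None < m - pdeg w)%N by rewrite -ltnS -subSn// in r_le *.
  apply: leq_trans (leq_add r_lt bound) _.
  by rewrite addnA subnK// ltnW.
rewrite leqNgt; apply/negP => lt_r.
have := f_row None _ lt_r; rewrite (bigD1 (Ordinal wdeg)) //= big1 => [|k kN].
  have -> : (pdeg w + (m - (pdeg w).+1).+1 == m)%N by lia.
  rewrite mul1r addr0 -wE /= => /eqP.
  by rewrite -/(lead_coef w) lead_coef_eq0 (negPf w0).
case: eqP => [kE|_]; last by rewrite mul0r.
by case/eqP: kN; apply: val_inj => /=; lia.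
Qed.

End DigitalNet.
(** * Digits of integers *)

Section IntegerDigits.
Variable b : nat.
Hypothesis b_gt1 : (1 < b)%N.
Let b_gt0 : (0 < b)%N := ltnW b_gt1.

Lemma ndigit_lt n r : (ndigit b n r < b)%N.
Proof. by rewrite ltn_pmod. Qed.

Lemma ndigit_small n r : (n < b ^ r)%N -> ndigit b n r = 0%N.
Proof. by move=> h; rewrite /ndigit divn_small ?mod0n. Qed.

Lemma ndigit_ge n r : (n <= r)%N -> ndigit b n r = 0%N.
Proof. by move=> nr; apply/ndigit_small/(leq_ltn_trans nr)/ltn_expl. Qed.

Lemma digit_sum_lt (c : nat -> nat) k : (forall r, (c r < b)%N) ->
  (\sum_(r < k) c r * b ^ r < b ^ k)%N.
Proof.
move=> cb; elim: k => [|k IH]; first by rewrite big_ord0.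
rewrite big_ord_recr /= expnS; apply: (@leq_trans (b ^ k + c k * b ^ k)).
  by rewrite ltn_add2r.
by rewrite -mulSn leq_mul2r cb orbT.
Qed.

Lemma ndigit_sum (c : nat -> nat) k l : (forall r, (c r < b)%N) ->
  ndigit b (\sum_(r < k) c r * b ^ r) l = if (l < k)%N then c l else 0%N.
Proof.
move=> cb; elim: k => [|k IH]; first by rewrite big_ord0 ndigit_ge.
have [lk|kl] := leqP k l; last first.
  move: IH; rewrite kl ltnS ltnW// => <-.
  rewrite big_ord_recr /= /ndigit -(subnK (ltnW kl)) expnD mulnA.
  rewrite divnDMl ?expn_gt0 ?b_gt0//.
  by rewrite -(subnSK kl) expnS mulnCA -modnDmr modnMr addn0.
have [->|nlk] := eqVneq l k.
  rewrite ltnSn big_ord_recr /= /ndigit divnDMl ?expn_gt0 ?b_gt0//.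
  by rewrite divn_small ?digit_sum_lt// add0n modn_small.
have kl : (k < l)%N by rewrite ltn_neqAle eq_sym nlk.
rewrite ltnS leqNgt kl ndigit_small// (leq_trans (digit_sum_lt _ cb))//.
by rewrite leq_exp2l.
Qed.

Lemma sum_ndigit n m : (\sum_(r < m) ndigit b n r * b ^ r = n %% b ^ m)%N.
Proof.
elim: m => [|m IH]; first by rewrite big_ord0 modn1.
rewrite big_ord_recr /= IH addnC.
have nE : n = (n %/ b ^ m %/ b * b ^ m.+1 + (ndigit b n m * b ^ m + n %% b ^ m))%N.
  by rewrite addnA expnS mulnA -mulnDl -divn_eq -divn_eq.
rewrite [in RHS]nE modnMDl [RHS]modn_small//.
rewrite expnS; apply: (@leq_trans (ndigit b n m * b ^ m + b ^ m)).
  by rewrite ltn_add2l ltn_pmod// expn_gt0 b_gt0.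
by rewrite -mulSnr leq_mul2r ndigit_lt orbT.
Qed.

Lemma sum_ndigit_small n m : (n < b ^ m)%N ->
  (\sum_(r < m) ndigit b n r * b ^ r = n)%N.
Proof. by move=> nm; rewrite sum_ndigit modn_small. Qed.

Lemma ndigit_inj m n n' : (n < b ^ m)%N -> (n' < b ^ m)%N ->
  (forall r, (r < m)%N -> ndigit b n r = ndigit b n' r) -> n = n'.
Proof.
move=> nm n'm h; rewrite -(sum_ndigit_small nm) -(sum_ndigit_small n'm).
by apply: eq_bigr => r _; rewrite h.
Qed.

Lemma ndigit_noplus n Q r :
  ndigit b (noplus b n Q) r = ((ndigit b n r + ndigit b Q r) %% b)%N.
Proof.
rewrite /noplus (ndigit_sum (c := fun r => (ndigit b n r + ndigit b Q r) %% b)%N).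
  by case: ltnP => //; rewrite geq_max => /andP[? ?]; rewrite !ndigit_ge ?mod0n.
by move=> l; rewrite ltn_pmod.
Qed.

Lemma ndigit_nominus n k r : (r < maxn n k)%N ->
  ndigit b (nominus b n k) r = ((ndigit b n r + (b - ndigit b k r)) %% b)%N.
Proof.
move=> rm; rewrite /nominus.
rewrite (ndigit_sum (c := fun r => (ndigit b n r + (b - ndigit b k r)) %% b)%N).
  by rewrite rm.
by move=> l; rewrite ltn_pmod.
Qed.

Lemma noplus_lt m n Q : (n < b ^ m)%N -> (Q < b ^ m)%N -> (noplus b n Q < b ^ m)%N.
Proof.
move=> nm Qm; set N := noplus b n Q.
have Nlt : (N < b ^ (m + N))%N.
  by apply: (leq_trans (ltn_expl N b_gt1)); rewrite leq_exp2l ?leq_addl.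
rewrite -(sum_ndigit_small Nlt) big_split_ord /= addnC big1 ?add0n => [|r _].
  by apply: digit_sum_lt => r; rewrite ndigit_lt.
have small k : (k < b ^ m)%N -> ndigit b k (m + r) = 0%N.
  by move=> km; apply/ndigit_small/(leq_trans km); rewrite leq_exp2l ?leq_addr.
by rewrite ndigit_noplus !small// mod0n mul0n.
Qed.

Lemma subdigit_eq0 x c : (x < b)%N -> (c < b)%N ->
  ((x + (b - c)) %% b == 0)%N = (x == c).
Proof.
move=> xb cb; apply/eqP/eqP => [h|->]; last by rewrite subnKC ?modnn// ltnW.
have /(congr1 (fun z => (z + c) %% b)%N) := h.
by rewrite modnDml -addnA subnK ?modnDr ?(ltnW cb)// add0n !modn_small.
Qed.

End IntegerDigits.

(** * Digit expansions of real numbers *)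

Section RealDigits.
Variables (R : realType) (b : nat).
Hypothesis b_gt1 : (1 < b)%N.

Let bR_gt0 : (0 : R) < b%:R.
Proof. by rewrite ltr0n ltnW. Qed.

Definition prefix_val (M : nat) (x : digits) : R :=
  \sum_(j < M) (x j)%:R * b%:R ^- j.+1.

Lemma prefix_valS M x :
  prefix_val M.+1 x = prefix_val M x + (x M)%:R * b%:R ^- M.+1.
Proof. by rewrite /prefix_val big_ord_recr. Qed.

Let wt_gt0 j : 0 < b%:R ^- j :> R.
Proof. by rewrite invr_gt0 exprn_gt0. Qed.

Let wtS j : b%:R ^- j = b%:R * b%:R ^- j.+1 :> R.
Proof. by rewrite exprS invfM mulrA divff ?mul1r// gt_eqF. Qed.

Lemma prefix_val_le1 M x : (forall j, (x j < b)%N) ->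
  prefix_val M x <= 1 - b%:R ^- M.
Proof.
move=> xb; elim: M => [|M IH]; first by rewrite /prefix_val big_ord0 invr1 subrr.
rewrite prefix_valS; apply: (le_trans (lerD IH (lexx _))).
rewrite (wtS M); have : (x M)%:R + 1 <= b%:R :> R by rewrite natr1 ler_nat.
have := wt_gt0 M.+1; nra.
Qed.

Lemma prefix_val_le_digits_val M x : (forall j, (x j < b)%N) ->
  prefix_val M x <= digits_val R b x.
Proof.
move=> xb; have serE N : series (fun j => (x j)%:R * b%:R ^- j.+1 : R) N = prefix_val N x.
  by rewrite /series /= big_mkord.
have nd : nondecreasing_seq (series (fun j => (x j)%:R * b%:R ^- j.+1 : R)).
  apply/nondecreasing_seqP => N; rewrite !serE prefix_valS lerDl.
  by rewrite mulr_ge0 ?ler0n// ltW.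
rewrite -serE; apply: nondecreasing_cvgn_le => //.
apply: nondecreasing_is_cvgn => //; exists 1 => _ [N _ <-]; rewrite serE.
by rewrite (le_trans (prefix_val_le1 N xb))// lerBlDr lerDl ltW.
Qed.

(** If [x] is not lexicographically below [c], then its prefix equals that of [c]
    or exceeds it by at least one unit in the last place; the latter form makes
    the induction on [M] work. *)
Lemma prefix_val_lt M (x c : digits) : (forall j, (c j < b)%N) ->
  prefix_val M x < prefix_val M c -> lex_below M x c.
Proof.
move=> cb; apply: contraTT; rewrite -leNgt => /existsPn nlex.
suff [/agreeP h|h] : agree x c M \/ prefix_val M c + b%:R ^- M <= prefix_val M x.
- by rewrite le_eqVlt; apply/orP; left; apply/eqP/eq_bigr => j _; rewrite h.
- by rewrite (le_trans _ h)// lerDl ltW.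
elim: M nlex => [|M IH] nlex; first by left.
have [j|agr|gap] := IH; first exact: (nlex (widen_ord (leqnSn M) j)).
  have := nlex ord_max; rewrite /branches agr /= -leqNgt leq_eqVlt => /orP[/eqP cx|cx].
    left; apply/agreeP => j; rewrite ltnS leq_eqVlt => /orP[/eqP -> //|].
    by move/agreeP: agr; apply.
  right; rewrite !prefix_valS.
  have -> : prefix_val M x = prefix_val M c.
    by apply: eq_bigr => j _; move/agreeP: agr => ->.
  have : (c M)%:R + 1 <= (x M)%:R :> R by rewrite natr1 ler_nat.
  have := wt_gt0 M.+1; nra.
right; rewrite !prefix_valS; apply: le_trans (le_trans gap _); last first.
  by rewrite lerDl mulr_ge0 ?ler0n// ltW.
rewrite (wtS M); have : (c M)%:R + 1 <= b%:R :> R by rewrite natr1 ler_nat.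
have := wt_gt0 M.+1; nra.
Qed.

(** The converse can fail when [x] ends in digits [b - 1], but this direction is
    enough to bound the number of points of a box from above. *)
Lemma digits_val_lt M (x c : digits) : (forall j, (x j < b)%N) ->
  (forall j, (c j < b)%N) ->
  digits_val R b x < prefix_val M c -> lex_below M x c.
Proof.
move=> xb cb h; apply: prefix_val_lt => //.
exact: le_lt_trans (prefix_val_le_digits_val M xb) h.
Qed.

Lemma prefix_val_gt0 M (c : digits) j : (j < M)%N -> c j != 0%N ->
  0 < prefix_val M c.
Proof.
move=> jM cj; rewrite /prefix_val (bigD1 (Ordinal jM)) //= ltr_pwDl//.
  by rewrite mulr_gt0// ltr0n lt0n.
by apply: sumr_ge0 => i _; rewrite mulr_ge0 ?ler0n// ltW.
Qed.

(** With the digits of [n < b ^ m] read from the leading one, this is [n]. *)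
Lemma prefix_val_rev m (c : nat -> nat) :
  b%:R ^+ m * prefix_val m (fun j => c (m - j.+1)%N)
  = (\sum_(r < m) c r * b ^ r)%N%:R :> R.
Proof.
rewrite /prefix_val mulr_sumr natr_sum (reindex_inj rev_ord_inj) /=.
apply: eq_bigr => j _; rewrite subnSK ?ltn_ord// subKn ?(ltnW (ltn_ord j))//.
rewrite natrM natrX mulrCA; congr (_ * _).
by rewrite -expfB_cond ?(gt_eqF bR_gt0) ?leq_subr// subKn// ltnW.
Qed.

Lemma local_discrepancy_le2 (s N : nat) (beta : nat -> 'I_s -> R) (z : 'I_s -> R) :
  (0 < N)%N -> (forall i, 0 < z i <= 1) ->
  `|#|[pred n : 'I_N | [forall i, 0 <= beta n i < z i]]|%:R / N%:R
    - \prod_(i < s) z i| <= 2.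
Proof.
move=> N0 z01; apply: (le_trans (ler_normB _ _)).
have card_le : #|[pred n : 'I_N | [forall i, 0 <= beta n i < z i]]|%:R / N%:R <= 1 :> R.
  rewrite ler_pdivrMr ?ltr0n// mul1r ler_nat.
  by rewrite (leq_trans (max_card _))// card_ord.
have prod_le : \prod_(i < s) z i <= 1.
  by apply: prodr_ile1 => i; have /andP[/ltW -> ->] := z01 i.
rewrite !ger0_norm ?divr_ge0 ?ler0n//; last first.
  by apply: prodr_ge0 => i _; have /andP[/ltW] := z01 i.
by rewrite (le_trans (lerD card_le prod_le)).
Qed.

Lemma star_discrepancy_le2 (s N : nat) (beta : nat -> 'I_s -> R) :
  (0 < N)%N -> star_discrepancy N beta <= 2.
Proof.
move=> N0; apply: ge_sup; last by move=> _ [z z01 ->]; apply: local_discrepancy_le2.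
by eexists; exists (fun=> 1); [move=> _; rewrite ltr01 lexx|reflexivity].
Qed.

Lemma discrepancy_ge (s N : nat) (beta : nat -> 'I_s -> R) (z : 'I_s -> R) (g : R) :
  (0 < N)%N -> (forall i, 0 < z i <= 1) ->
  #|[pred n : 'I_N | [forall i, 0 <= beta n i < z i]]|%:R + g
    <= N%:R * \prod_(i < s) z i ->
  g <= N%:R * star_discrepancy N beta.
Proof.
move=> N0 z01 hg; set A := #|_| in hg.
have NR : 0 < N%:R :> R by rewrite ltr0n.
apply: (le_trans (y := N%:R * `|A%:R / N%:R - \prod_(i < s) z i|)).
  rewrite -{1}(gtr0_norm NR) -normrM mulrBr mulrCA divff ?gt_eqF// mulr1.
  by rewrite distrC; apply: le_trans (ler_norm _); rewrite lerBrDl.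
apply: ler_wpM2l; first exact: ltW.
apply: ub_le_sup; last by exists z.
by exists 2 => _ [z' z'01 ->]; apply: local_discrepancy_le2.
Qed.

End RealDigits.
(** * Admissibility of the sequence *)

Section DigitalSequence.
Variables (F : finFieldType) (s : nat).
Variables (phi : 'I_#|F| -> F) (phi_inv : F -> 'I_#|F|).
Hypothesis phiK : cancel phi phi_inv.
Hypothesis phi_invK : cancel phi_inv phi.
Hypothesis phi0 : forall z : 'I_#|F|, z = 0%N :> nat -> phi z = 0.
Variable p : 'I_s -> {poly F}.
Variable a : 'I_s -> nat -> nat -> nat -> F.

Let b := #|F|.
Let e i := pdeg (p i).
Let row i := niederreiter_matrix (e i) (a i).
Let x := digital_seq phi phi_inv row.

Let b_gt1 : (1 < b)%N.
Proof. exact: card_finNzRing_gt1. Qed.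

Definition index_poly (n : nat) : {poly F} := \poly_(r < n) phi (ndigitZ F n r).

Lemma coef_index_poly n r : (index_poly n)`_r = phi (ndigitZ F n r).
Proof.
rewrite coef_poly; case: ltnP => // nr.
by rewrite phi0//=; exact: ndigit_ge.
Qed.

Lemma size_index_poly m n : (n < b ^ m)%N -> (size (index_poly n) <= m)%N.
Proof.
move=> nm; apply/leq_sizeP => r mr; rewrite coef_index_poly phi0//.
by apply/ndigit_small/(leq_trans nm); rewrite leq_exp2l.
Qed.

Lemma index_poly_inj m n n' : (n < b ^ m)%N -> (n' < b ^ m)%N ->
  index_poly n = index_poly n' -> n = n'.
Proof.
move=> nm n'm nn'; apply: (ndigit_inj b_gt1 nm n'm) => r _.
have := congr1 (fun q : {poly F} => q`_r) nn'.
by rewrite /= !coef_index_poly => /(can_inj phiK)/(congr1 val).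
Qed.

Lemma digital_seqE n i j : x n i j = phi_inv (residue (row i j) (index_poly n)).
Proof.
rewrite /x /digital_seq (@residue_widen _ _ _ n) ?size_poly//.
by congr (val (phi_inv _)); apply: eq_bigr => r _; rewrite coef_index_poly.
Qed.

Lemma digital_seq_lt n i j : (x n i j < b)%N.
Proof. by rewrite digital_seqE. Qed.

Definition index_vec (m n : nat) : 'rV[F]_m := poly_rV (index_poly n).

Lemma index_vec_inj m n n' : (n < b ^ m)%N -> (n' < b ^ m)%N ->
  index_vec m n = index_vec m n' -> n = n'.
Proof.
move=> nm n'm /(congr1 rVpoly).
rewrite !poly_rV_K ?(size_index_poly nm) ?(size_index_poly n'm)//.
exact: index_poly_inj nm n'm.
Qed.

Lemma coord_digit_Some m shift n i j : (n < b ^ m)%N ->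
  coord_digit phi_inv p a shift (index_vec m n) (Some i) j
  = ((x n i j + shift (Some i) j) %% b)%N.
Proof.
move=> nm; rewrite /coord_digit digital_seqE (residue_widen _ (size_index_poly nm)).
by congr ((val (phi_inv _) + _) %% _)%N; apply: eq_bigr => r _; rewrite mxE.
Qed.

Lemma coord_digit_None m shift n j : (n < b ^ m)%N -> (j < m)%N ->
  coord_digit phi_inv p a shift (index_vec m n) None j
  = ((ndigit b n (m - j.+1) + shift None j) %% b)%N.
Proof.
move=> nm jm; have rm : (m - j.+1 < m)%N by lia.
rewrite /coord_digit (bigD1 (Ordinal rm)) //= big1 ?addr0 => [|r rN].
  have -> : (m - j.+1 + j.+1 == m)%N by lia.
  by rewrite mul1r mxE coef_index_poly phiK.
case: eqP => [rj|_]; last by rewrite mul0r.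
by case/eqP: rN; apply: val_inj => /=; lia.
Qed.

Hypothesis p_deg : forall i, (1 <= pdeg (p i))%N.
Hypothesis p_coprime : forall i i', i != i' -> coprimep (p i) (p i').
Variable y : 'I_s -> nat -> nat -> {poly F}.
Hypothesis y_indep : forall (i : 'I_s) (j : nat), (1 <= j)%N ->
  lin_indep_mod (p i) (pdeg (p i)) (y i j).
Hypothesis a_expansion : forall (i : 'I_s) (j k : nat), (1 <= j)%N ->
  (k < pdeg (p i))%N -> expansion (y i j k) (p i ^+ j) (a i j k).

(** The digits of [x n] and [x k] agree where the functionals vanish on the
    difference [u] of the index polynomials, and the leading digit of
    [nominus b n k] sits at [pdeg u]: digitwise differences are only tested for
    being 0, and such tests commute with the bijection [phi]. *)
Theorem niederreiter_admissible (R : realType) :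
  admissible R b (\sum_i e i) x.
Proof.
have bR : 0 < b%:R :> R by rewrite ltr0n ltnW.
apply: lb_le_inf; first by eexists; exists 1%N, 0%N; split.
move=> _ [n [k [kn ->]]].
have nb : (n < b ^ n)%N := ltn_expl n b_gt1.
have kb : (k < b ^ n)%N := ltn_trans kn nb.
pose u := index_poly n - index_poly k.
have u0 : u != 0.
  by rewrite subr_eq0; apply: contraTneq kn => /(index_poly_inj nb kb) ->; rewrite ltnn.
have norm_ge : (b ^ pdeg u <= nat_norm b (nominus b n k))%N.
  rewrite leq_exp2l// trunc_log_max//.
  have : lead_coef u != 0 by rewrite lead_coef_eq0.
  rewrite /lead_coef -/(pdeg u) coefB !coef_index_poly subr_eq0 => dig.
  rewrite leqNgt; apply: contraNN dig => small; apply/eqP; congr phi.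
  apply: val_inj => /=.
  have [big|lt_u] := leqP (maxn n k) (pdeg u).
    by move: big; rewrite geq_max => /andP[? ?]; rewrite -!/(ndigit _ _ _) !ndigit_ge.
  apply/eqP; rewrite -!/(ndigit _ _ _) -(subdigit_eq0 (b := b)) ?ndigit_lt//.
  by rewrite -ndigit_nominus// ndigit_small.
have row_u i j : x n i j = x k i j -> residue (row i j) u = 0.
  rewrite !digital_seqE => /val_inj/(can_inj phi_invK) nk.
  by rewrite linearB /= nk subrr.
(* Equality of all digits in one coordinate would allow arbitrarily large [r i]. *)
have diff i : exists j, dominus b (x n i) (x k i) j != 0%N.
  apply: contrapT => same.
  pose r i' := if i' == i then (pdeg u + \sum_i e i)%N else 0%N.
  have : ((pdeg u + \sum_i e i).+1 <= pdeg u + \sum_i e i)%N.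
    apply: leq_trans (common_zeros p_deg p_coprime y_indep a_expansion (r := r) u0 _).
      by rewrite [X in (_ <= X)%N](bigD1 i)//= /r eqxx leq_addr.
    rewrite /r => i' j; case: eqP => // -> _; apply: row_u.
    apply/eqP; rewrite -(subdigit_eq0 (b := b)) ?digital_seq_lt//.
    by apply/negPn/negP => neq; apply: same; exists j.
  by rewrite ltnn.
pose r i := ex_minn (diff i).
have normE i : digits_norm R b (dominus b (x n i) (x k i)) = b%:R ^- (r i).+1.
  rewrite /digits_norm; case: pselect => [h|[]]; last exact: diff.
  by rewrite /r; case: ex_minnP => j1 ? m1; case: ex_minnP => j2 ? m2;
    have -> : j1 = j2 by apply/eqP; rewrite eqn_leq m1// m2.
have r_le : (\sum_i (r i).+1 <= pdeg u + \sum_i e i)%N.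
  apply: (common_zeros p_deg p_coprime y_indep a_expansion u0) => i j jr.
  apply: row_u; apply/eqP; rewrite -(subdigit_eq0 (b := b)) ?digital_seq_lt//.
  move: jr; rewrite /r; case: ex_minnP => l _ lmin jl.
  by rewrite -leqn0 leqNgt lt0n; apply: contraTN jl => /lmin; rewrite -leqNgt.
rewrite /digits_vnorm (eq_bigr _ (fun i _ => normE i)) prodfV -expr_sum.
apply: (le_trans (y := b%:R ^+ pdeg u * b%:R ^- \sum_i (r i).+1)); last first.
  by rewrite ler_wpM2r ?invr_ge0 ?exprn_ge0 ?(ltW bR)// -natrX ler_nat.
rewrite ler_pdivlMr ?exprn_gt0// mulrC ler_pdivrMr ?exprn_gt0//.
by rewrite -exprD ler_weXn2l// ler1n ltnW.
Qed.

End DigitalSequence.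
(** * Large discrepancy of shifted Niederreiter points *)

Lemma lex_below_eq M (x x' c : nat -> nat) :
  (forall j, (j < M)%N -> x j = x' j) -> lex_below M x c -> lex_below M x' c.
Proof.
move=> xx' /existsP[j /andP[/agreeP agr lt]]; apply/existsP; exists j.
rewrite /branches -xx'// lt andbT; apply/agreeP => l lj.
by rewrite -xx' ?agr// (ltn_trans lj).
Qed.

Lemma admissible_net_Some (b m d t : nat) (I T : finType)
    (X : T -> option I -> nat -> nat) : (0 < b)%N ->
  admissible_net b m d t X -> admissible_net b m d t (fun n i => X n (Some i)).
Proof.
move=> b_gt0 [Xb X_card X_sep]; split=> [n i j|r c cb rt|n n' r nn' agr]; first exact: Xb.
- pose r' i := if i is Some i then r i else 0%N.
  pose c' i := if i is Some i then c i else fun=> 0%N.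
  have rr' : (\sum_i r' i = \sum_i r i)%N by rewrite big_option.
  rewrite -rr' in rt *; apply: leq_trans (X_card r' c' _ rt); last first.
    by case.
  apply: subset_leq_card; apply/fintype.subsetP => n; rewrite !inE => /forallP agr.
  by apply/forallP => -[i|]; [apply: agr|apply/agreeP].
have := X_sep n n' (fun i => if i is Some i then r i else 0%N) nn'.
rewrite big_option /= => h; apply: leq_trans (h _); first exact: leq_addl.
by case=> [i|]; [apply: agr|apply/agreeP].
Qed.

Section Discrepancy.
Variables (R : realType) (F : finFieldType) (s : nat).
Variables (phi : 'I_#|F| -> F) (phi_inv : F -> 'I_#|F|).
Hypothesis phiK : cancel phi phi_inv.
Hypothesis phi_invK : cancel phi_inv phi.
Hypothesis phi0 : forall z : 'I_#|F|, z = 0%N :> nat -> phi z = 0.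
Variable p : 'I_s -> {poly F}.
Hypothesis p_deg : forall i, (1 <= pdeg (p i))%N.
Hypothesis p_coprime : forall i i', i != i' -> coprimep (p i) (p i').
Variable y : 'I_s -> nat -> nat -> {poly F}.
Hypothesis y_indep : forall (i : 'I_s) (j : nat), (1 <= j)%N ->
  lin_indep_mod (p i) (pdeg (p i)) (y i j).
Variable a : 'I_s -> nat -> nat -> nat -> F.
Hypothesis a_expansion : forall (i : 'I_s) (j k : nat), (1 <= j)%N ->
  (k < pdeg (p i))%N -> expansion (y i j k) (p i ^+ j) (a i j k).

Let b := #|F|.
Let e i := pdeg (p i).
Let d := (\sum_i e i)%N.
Let t := (d - s)%N.
Let Sp := (d + t).+1.
Let row i := niederreiter_matrix (e i) (a i).
Let x := digital_seq phi phi_inv row.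

Let b_gt1 : (1 < b)%N.
Proof. exact: card_finNzRing_gt1. Qed.

Let s_le_d : (s <= d)%N.
Proof.
rewrite -[X in (X <= _)%N]card_ord -sum1_card; apply: leq_sum => i _.
exact: p_deg.
Qed.

Let e_le_d i : (e i <= d)%N.
Proof. by rewrite /d (bigD1 i)//= leq_addr. Qed.

(** A common divisor of ['X^w] and the product of the moduli is a power of ['X]
    dividing [p i1 ^+ q i1], whose degree is at most [V]. *)
Lemma gcdp_Xn_modulus (i1 : 'I_s) (q : 'I_s -> nat) (w V : nat) :
  (forall i, i != i1 -> coprimep 'X (p i)) -> (q i1 * e i1 <= V)%N ->
  gcdp 'X^w (modulus p q) %| 'X^V.
Proof.
move=> Xp qV; set g := gcdp _ _.
have gX : g %| 'X^w by apply: dvdp_gcdl.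
have gp : g %| p i1 ^+ q i1.
  have : g %| modulus p q by apply: dvdp_gcdr.
  rewrite /modulus (bigD1 i1)//= Gauss_dvdpl//.
  apply: (coprimep_dvdr gX).
  apply: (big_ind (coprimep 'X^w)) => [|u v|i ii1].
  - exact: coprimep1.
  - by rewrite coprimepMr => -> ->.
  - by apply/coprimep_expl/coprimep_expr/Xp.
have := gX; rewrite -['X]subr0 -polyC0 => /dvdp_exp_XsubCP[k kw gk].
rewrite (eqp_dvdl _ gk); apply: dvdp_exp2l.
have p0 : p i1 ^+ q i1 != 0 by rewrite expf_neq0// (pfactor_neq0 p_deg).
apply: leq_trans qV; have := dvdp_leq p0 gp; rewrite (eqp_size gk).
rewrite size_exp_XsubC -[size (p i1 ^+ _)]prednK ?size_poly_gt0//.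
by rewrite size_exp ltnS mulnC.
Qed.

Lemma exists_X_coprime : (0 < s)%N ->
  exists i1, forall i, i != i1 -> coprimep 'X (p i).
Proof.
move=> s0; have [/existsP[i1 Xi1]|] := boolP [exists i, 'X %| p i].
  exists i1 => i ii1; apply: coprimep_dvdr Xi1 _.
  by rewrite coprimep_sym; apply: p_coprime.
move=> /existsPn nX; exists (Ordinal s0) => i _.
rewrite coprimep_sym -['X]subr0 -polyC0 coprimep_XsubC -dvdp_XsubCl.
by rewrite polyC0 subr0.
Qed.

Lemma ndigit_noplusK n Q r :
  ((ndigit b (noplus b n Q) r + (b - ndigit b Q r)) %% b = ndigit b n r)%N.
Proof.
rewrite ndigit_noplus// modnDml -addnA subnKC ?modnDr ?modn_small ?ndigit_lt//.
by rewrite ltnW// ndigit_lt.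
Qed.

(** The prescribed index digits occupy the columns from [m - hi] to [m - lo - 1],
    and the near rows must be independent on the other ones.  If ['X] divides some
    [p i1], then the rows of [i1] live partly on the first columns only; the
    offset [L] given to another coordinate [i2] raises [m - hi] above them.  This
    is why two coordinates are required. *)
Theorem sequence_discrepancy (G m Q : nat) (w : 'I_s -> digits) :
  (2 <= s)%N -> (0 < G)%N -> (2 * t + 2 * (s + 1) * (Sp * G) <= m)%N ->
  (Q < b ^ m)%N ->
  exists2 N : nat, (1 <= N <= b ^ m)%N &
    (G ^ s)%:R * (b.-1%:R * b%:R ^- d.+1)
    <= N%:R * star_discrepancy N (fun n i =>
         digits_val R b (doplus b (x (noplus b n Q) i) (w i))).
Proof.
move=> s2 G0 fits Qm.
have [i1 Xi1] := exists_X_coprime (ltnW s2).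
have [i2 i21] : exists i2 : 'I_s, i2 != i1.
  have : (0 < #|predC1 i1|)%N by rewrite cardC1 card_ord -subn1 subn_gt0.
  by case/card_gt0P => i2; exists i2.
pose L := (Sp * G)%N.
pose U (i : option 'I_s) := if i == Some i2 then L else 0%N.
pose shift (i : option 'I_s) j :=
  if i is Some i then w i j else (b - ndigit b Q (m - j.+1))%N.
pose X := coord_digit phi_inv p a shift (m := m).
have X_net : admissible_net b m d t X.
  exact: (digital_admissible_net phiK phi_invK p_deg p_coprime y_indep a_expansion).
have U_sum : (\sum_(i | i != None) U i = L)%N.
  rewrite (bigD1 (Some i2)) //= {1}/U eqxx big1 ?addn0// => i /andP[_ ni].
  by rewrite /U (negPf ni).
have I_card : #|{: option 'I_s}| = s.+1 by rewrite card_option card_ord.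
(* The far window, in the numbering of digits from the leading one. *)
pose lo := (m - (t + L + L * s))%N; pose hi := ((m + d).+1 - (L + Sp * s))%N.
pose P := [pred k : option 'I_s * 'I_m |
  if k.1 is Some _ then k.2 < U k.1 + L else lo <= k.2 < hi]%N.
pose v (i : option 'I_s) j := if i is Some _
  then if (U i < j.+1)%N && (Sp %| j.+1 - U i)%N then b.-1 else 0%N
  else if (Sp %| (m + d).+1 - L - j.+1)%N then b.-1 else 0%N.
have v_lt i j : (v i j < b)%N.
  by rewrite /v; case: i => [i|]; case: ifP => _; rewrite ?(ltnW b_gt1)// prednK ?(ltnW b_gt1).
have SpL : (Sp <= L)%N by rewrite leq_pmulr.
have Sps : (2 * Sp <= Sp * s)%N by rewrite mulnC leq_mul2l s2 orbT.
have Spd : (d + t < Sp)%N by [].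
have LsE : (2 * (s + 1) * L = 2 * (L * s) + 2 * L)%N by rewrite /L; ring.
have Ls : (L <= L * s)%N by rewrite leq_pmulr// ltnW.
have SpsL : (Sp * s <= L * s)%N by rewrite leq_mul2r SpL orbT.
have fits' : (2 * t + 2 * (L * s) + 2 * L <= m)%N by rewrite -addnA -LsE.
pose q (i : 'I_s) := ((U (Some i) + L + (e i).-1) %/ e i)%N.
have q_ge i : (U (Some i) + L <= q i * e i < U (Some i) + L + e i)%N.
  exact: ceil_mul (p_deg i).
have q_sum : (\sum_i q i * e i <= L + L * s + t)%N.
  suff h : (\sum_i q i * e i + s <= L + L * s + d)%N.
    by rewrite -(leq_add2r s) -addnA subnK.
  have <- : (\sum_(i < s) (U (Some i) + L) = L + L * s)%N.
    rewrite big_split /= sum_nat_const card_ord mulnC; congr (_ + _)%N.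
    by rewrite -[RHS]U_sum [RHS]big_mkcond big_option /= add0n.
  rewrite -[X in (_ + X <= _)%N](card_ord s) -sum1_card -!big_split /=.
  apply: leq_sum => i _.
  by rewrite addn1; case/andP: (q_ge i).
have wq : (m - lo + \sum_i q i * e i <= m)%N.
  apply: (@leq_trans (m - lo + (L + L * s + t))); first by rewrite leq_add2l.
  by rewrite /lo; lia.
have [z zP] : exists z, forall i (j : 'I_m), P (i, j) -> X z i j = v i j.
  apply: (prescribed_point phiK phi_invK) v_lt => c cN cm c0.
  apply: (coord_rows_free p_deg p_coprime y_indep a_expansion
            (q := q) (w := m - lo) (V := m - hi)) => //.
  - apply: (gcdp_Xn_modulus _ Xi1); have /andP[_] := q_ge i1.
    rewrite /U (inj_eq (@Some_inj _)) eq_sym (negPf i21) add0n.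
    by have := e_le_d i1; rewrite /hi; lia.
  - exact: leq_subr.
  - move=> i j; rewrite geq_min => /orP[qj|/cm//].
    have [jm|/cm//] := ltnP j m.
    apply: (cN (Some i) (Ordinal jm)); rewrite inE /= -leqNgt.
    by apply: leq_trans qj; case/andP: (q_ge i).
  move=> r hr; have rm : (r < m)%N.
    by case/orP: hr => [/leq_trans|/andP[_ /leq_trans]]; apply; rewrite ?leq_subr.
  have jm : (m - r.+1 < m)%N by lia.
  apply: (cN None (Ordinal jm)); rewrite inE /=.
  by case/orP: hr => [|/andP[+ _]]; lia.
have z_near i j : i != None -> (j < U i + Sp * G)%N ->
    X z i j = if (U i < j.+1)%N && (Sp %| j.+1 - U i)%N then b.-1 else 0%N.
  case: i => // i _ jU; have jm : (j < m)%N.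
    by apply: leq_trans jU _; rewrite /U; case: ifP => _; lia.
  by rewrite (zP (Some i) (Ordinal jm)).
have z_far j : (m - (t + L + Sp * G * s) <= j < (m + d).+1 - (L + Sp * s))%N ->
    X z None j = if (Sp %| (m + d).+1 - L - j.+1)%N then b.-1 else 0%N.
  move=> hj; have jm : (j < m)%N by lia.
  by rewrite (zP None (Ordinal jm)).
have fits'' : (t + L + Sp * G * s <= m)%N by rewrite -/L; lia.
have [Y [Y_lt Y_nz Y_box]] := spaced_corner R b_gt1 X_net G0 U_sum I_card
  (ltnW s2) fits'' z_near z_far.
(* The far coordinate of the corner is [N / b ^ m]. *)
pose N := (\sum_(r < m) Y None (m - r.+1) * b ^ r)%N.
have N_val : b%:R ^+ m * prefix_val R b m (Y None) = N%:R.
  rewrite -(prefix_val_rev R b_gt1 m (fun r => Y None (m - r.+1)%N)).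
  congr (_ * _); apply: eq_bigr => j _; congr ((Y None _)%:R * _).
  by rewrite subnSK// subKn// ltnW.
have bm_gt0 : 0 < b%:R ^+ m :> R by rewrite exprn_gt0// ltr0n ltnW.
have val01 i : 0 < prefix_val R b m (Y i) <= 1.
  have [j jm Yj] := Y_nz i; rewrite (prefix_val_gt0 R b_gt1 jm Yj) /=.
  apply: le_trans (prefix_val_le1 R b_gt1 m (Y_lt i)) _.
  by rewrite lerBlDr lerDl invr_ge0 exprn_ge0.
have /andP[valN_gt0 valN_le1] := val01 None.
have N_gt0 : (0 < N)%N by rewrite -(ltr0n R) -N_val mulr_gt0.
have N_le : (N <= b ^ m)%N.
  by rewrite -(ler_nat R) -N_val natrX ler_piMr// ltW.
exists N; first by rewrite N_gt0 N_le.
apply: (@discrepancy_ge R s N _ (fun i => prefix_val R b m (Y (Some i)))) => //.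
move: Y_box; rewrite big_option /= [_ ^+ m * _]mulrA -/(prefix_val R b m (Y None)) N_val.
apply: le_trans; rewrite lerD2r ler_nat.
pose f (n : 'I_N) := index_vec phi m (noplus b n Q).
have n_lt (n : 'I_N) : (n < b ^ m)%N := leq_trans (ltn_ord n) N_le.
have n'_lt (n : 'I_N) := noplus_lt b_gt1 (n_lt n) Qm.
have f_inj : injective f.
  move=> n n' /(index_vec_inj phiK phi0 (n'_lt n) (n'_lt n')) nn'.
  apply/val_inj/(ndigit_inj b_gt1 (n_lt n) (n_lt n')) => r _.
  by rewrite -(ndigit_noplusK n Q) nn' ndigit_noplusK.
rewrite -(card_imset _ f_inj); apply: subset_leq_card.
apply/fintype.subsetP => _ /imsetP[n + ->]; rewrite !inE => /forallP hn.
apply/forallP => -[i|].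
  have /andP[_] := hn i; move=> /(digits_val_lt b_gt1) h.
  apply: lex_below_eq (h _ (Y_lt _)) => [j _|j]; last by rewrite ltn_pmod// ltnW.
  by rewrite /X /f (coord_digit_Some phi_inv phi0 p a shift i j (n'_lt n)).
apply: (@lex_below_eq _ (fun j => ndigit b n (m - j.+1))) => [j jm|].
  rewrite /X /f (coord_digit_None phiK phi0 p a shift (n'_lt n) jm) /=.
  by rewrite ndigit_noplusK.
apply: (prefix_val_lt (R := R) b_gt1 (Y_lt _)).
rewrite -(ltr_pM2l bm_gt0) N_val prefix_val_rev// sum_ndigit_small//.
by rewrite ltr_nat.
Qed.

(** The hypothesis on the degrees makes the far rows vanish on the first
    [Sp * G * s.-1 + t] columns, which suffice to make the near rows independent;
    the far rows are then independent on all [m] columns. *)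
Theorem net_discrepancy (G m : nat) (i0 : 'I_s) (w : 'I_s -> digits) :
  (3 <= s)%N -> (0 < G)%N -> (t + Sp * G * s.-1 <= m)%N ->
  (forall j k, (m - (t + Sp * G * s.-1) < j * e i0 <= m)%N -> (k < e i0)%N ->
     (Sp * G * s.-1 + t + pdeg (y i0 j k) < j * e i0)%N) ->
  (G ^ s.-1)%:R * (b.-1%:R * b%:R ^- d.+1)
  <= (b ^ m)%:R * star_discrepancy (b ^ m) (fun n i =>
       digits_val R b (doplus b (x n i) (w i))).
Proof.
move=> s3 G0 fits y_small; pose L := (Sp * G)%N.
pose shift (i : option 'I_s) j := if i is Some i then w i j else 0%N.
pose X := coord_digit phi_inv p a shift (m := m).
have X_net : admissible_net b m d t X.
  exact: (digital_admissible_net phiK phi_invK p_deg p_coprime y_indep a_expansion).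
have U_sum : (\sum_(i < s | i != i0) 0 = 0)%N by rewrite big1.
have sE : s = s.-1.+1 by rewrite prednK// (ltn_trans _ s3).
have I_card : #|'I_s| = s.-1.+1 by rewrite card_ord.
pose lo := (m - (t + L * s.-1))%N; pose hi := ((m + d).+1 - Sp * s.-1)%N.
pose P := [pred k : option 'I_s * 'I_m |
  if k.1 is Some i then if i == i0 then lo <= k.2 < hi else k.2 < L
  else false]%N.
pose v (i : option 'I_s) j := if i == Some i0
  then if (Sp %| (m + d).+1 - j.+1)%N then b.-1 else 0%N
  else if (Sp %| j.+1)%N then b.-1 else 0%N.
have v_lt i j : (v i j < b)%N.
  by rewrite /v; case: ifP => _; case: ifP => _; rewrite ?(ltnW b_gt1)// prednK ?(ltnW b_gt1).
have SpL : (Sp <= L)%N by rewrite leq_pmulr.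
have Sps : (2 * Sp <= Sp * s.-1)%N by rewrite mulnC leq_mul2l -ltnS -sE s3 orbT.
have Spd : (d + t < Sp)%N by [].
have Ls : (L <= L * s.-1)%N by rewrite leq_pmulr// -ltnS -sE ltnW.
have SpsL : (Sp * s.-1 <= L * s.-1)%N by rewrite leq_mul2r SpL orbT.
have ed := e_le_d i0.
have e0_gt0 : (0 < e i0)%N := p_deg i0.
pose q i := if i == i0 then 0%N else ((L + (e i).-1) %/ e i)%N.
have q_sum : (\sum_i q i * e i <= L * s.-1 + t)%N.
  suff h : (\sum_i q i * e i + s <= L * s.-1 + d)%N.
    by rewrite -(leq_add2r s) -addnA subnK.
  have <- : (\sum_(i < s) (if i == i0 then 0 else L) = L * s.-1)%N.
    rewrite (bigD1 i0) //= eqxx add0n (eq_bigr (fun=> L)) => [|i /negPf ->//].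
    by rewrite sum_nat_const cardC1 card_ord mulnC.
  rewrite -[X in (_ + X <= _)%N](card_ord s) -sum1_card -!big_split /=.
  apply: leq_sum => i _; rewrite /q; case: eqP => _; first by rewrite p_deg.
  by rewrite addn1; case/andP: (ceil_mul L (p_deg i)).
pose q' i := if i == i0 then ((hi + (e i0).-1) %/ e i0)%N else 0%N.
have /andP[q'_ge q'_le] := ceil_mul hi e0_gt0.
have q'_sum : (\sum_i q' i * e i = (hi + (e i0).-1) %/ e i0 * e i0)%N.
  rewrite (bigD1 i0) //= /q' eqxx big1 ?addn0// => i /negPf ->.
  by rewrite mul0n.
have [z zP] : exists z, forall i (j : 'I_m), P (i, j) -> X z i j = v i j.
  apply: (prescribed_point phiK phi_invK) v_lt => c cN cm c0.
  have c_near i j : i != i0 -> (L <= j)%N -> c (Some i) j = 0.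
    move=> ii0 Lj; have [jm|/cm//] := ltnP j m.
    by apply: (cN (Some i) (Ordinal jm)); rewrite inE /= (negPf ii0) -leqNgt.
  have c_far j : ~~ (lo <= j < hi)%N -> c (Some i0) j = 0.
    move=> nj; have [jm|/cm//] := ltnP j m.
    by apply: (cN (Some i0) (Ordinal jm)); rewrite inE /= eqxx.
  have c_none j : c None j = 0.
    by have [jm|/cm//] := ltnP j m; apply: (cN None (Ordinal jm)).
  have row_sum r : (r < m)%N ->
      \sum_i \sum_(j < m) c (Some i) j * row i j r = 0.
    move=> rm; have := c0 r rm; rewrite big_option /= big1 ?add0r// => j _.
    by rewrite c_none mul0r.
  (* The exponent [J = j %/ e i0 + 1] of a far row satisfies [lo < J * e i0 <= m]. *)
have far0 r : (r < L * s.-1 + t)%N -> \sum_(j < m) c (Some i0) j * row i0 j r = 0.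
    move=> rL; apply: big1 => j _.
    have [jlh|/c_far ->] := boolP (lo <= j < hi)%N; last by rewrite mul0r.
    suff -> : row i0 j r = 0 by rewrite mulr0.
    have je : (j < (j %/ e i0).+1 * e i0 <= j + e i0)%N.
      by rewrite ltn_ceil//= mulSn addnC leq_add2r leq_divM.
    apply: (expansion_small (a_expansion (ltn0Sn _) (ltn_pmod j e0_gt0))).
    have -> : pdeg (p i0 ^+ (j %/ e i0).+1) = ((j %/ e i0).+1 * e i0)%N.
      by rewrite /pdeg size_exp mulnC.
    have := y_small (j %/ e i0).+1 (j %% e i0)%N _ (ltn_pmod j e0_gt0).
    rewrite -/L; move: (pdeg (y _ _ _)) => k.
    move: ((j %/ e i0).+1 * e i0)%N je => J je h.
    suff : (L * s.-1 + t + k < J)%N by lia.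
    apply: h; rewrite /lo /hi in jlh; lia.
  have near0 i j : i != i0 -> c (Some i) j = 0.
    move=> ii0; pose c1 i j := if i == i0 then 0 else c (Some i) j.
    have -> : c (Some i) j = c1 i j by rewrite /c1 (negPf ii0).
    apply: (rows_window p_deg p_coprime y_indep a_expansion
              (q := q) (w := 0) (V := 0) (B := m)); first by rewrite dvdp_gcdl.
      move=> i' j' hj; rewrite /c1; case: eqP => // /eqP ii'.
      move: hj; rewrite geq_min => /orP[|/cm//]; rewrite /q (negPf ii') => qj.
      apply: c_near => //; apply: leq_trans qj.
      by case/andP: (ceil_mul L (p_deg i')).
    move=> r; rewrite ltn0 add0n /= => rq.
    have rL : (r < L * s.-1 + t)%N := leq_trans rq q_sum.
    rewrite -[RHS](row_sum r); last by rewrite (leq_trans rL)// addnC.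
    apply: eq_bigr => i' _; rewrite /c1; case: eqP => // ->.
    by rewrite far0// big1 // => j' _; rewrite mul0r.
  move=> [i|] j jm //; have [->|/near0 //] := eqVneq i i0.
  pose c2 i j := if i == i0 then c (Some i) j else 0.
  have -> : c (Some i0) j = c2 i0 j by rewrite /c2 eqxx.
  apply: (rows_window p_deg p_coprime y_indep a_expansion
            (q := q') (w := 0) (V := 0) (B := m)); first by rewrite dvdp_gcdl.
    move=> i' j'; rewrite /c2; case: eqP => // ->.
    rewrite geq_min => /orP[|/cm//]; rewrite /q' eqxx => qj.
    by apply: c_far; rewrite negb_and -!leqNgt (leq_trans q'_ge qj) orbT.
  move=> r; rewrite ltn0 add0n q'_sum /= => rq.
  have rm : (r < m)%N.
    by apply: leq_trans rq _; rewrite /hi in q'_le *; lia.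
  rewrite -[RHS](row_sum r rm); apply: eq_bigr => i' _; rewrite /c2.
  case: eqP => // /eqP ii'; apply: eq_bigr => j' _.
  by rewrite near0// mul0r.
have z_near i j : i != i0 -> (j < 0 + Sp * G)%N ->
    X z (Some i) j = if (0 < j.+1)%N && (Sp %| j.+1 - 0)%N then b.-1 else 0%N.
  move=> ii0 jL; have jm : (j < m)%N by rewrite add0n -/L in jL; lia.
  have := zP (Some i) (Ordinal jm); rewrite inE /= (negPf ii0) => ->; last by [].
  by rewrite /v (inj_eq (@Some_inj _)) (negPf ii0) subn0.
have z_far j : (m - (t + 0 + Sp * G * s.-1) <= j < (m + d).+1 - (0 + Sp * s.-1))%N ->
    X z (Some i0) j = if (Sp %| (m + d).+1 - 0 - j.+1)%N then b.-1 else 0%N.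
  rewrite addn0 add0n => hj; have jm : (j < m)%N by lia.
  have := zP (Some i0) (Ordinal jm); rewrite inE /= eqxx => -> //.
  by rewrite /v eqxx subn0.
have fits0 : (t + 0 + Sp * G * s.-1 <= m)%N by rewrite addn0.
have s1_gt0 : (0 < s.-1)%N by rewrite -ltnS -sE ltnW.
have [Y [Y_lt Y_nz Y_box]] := spaced_corner R b_gt1
  (admissible_net_Some (ltnW b_gt1) X_net) G0 U_sum I_card s1_gt0 fits0 z_near z_far.
have val01 i : 0 < prefix_val R b m (Y i) <= 1.
  have [j jm Yj] := Y_nz i; rewrite (prefix_val_gt0 R b_gt1 jm Yj) /=.
  apply: le_trans (prefix_val_le1 R b_gt1 m (Y_lt i)) _.
  by rewrite lerBlDr lerDl invr_ge0 exprn_ge0.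
apply: (@discrepancy_ge R s _ _ (fun i => prefix_val R b m (Y i))) => //.
  by rewrite expn_gt0 ltnW.
rewrite [(b ^ m)%:R]natrX; apply: le_trans Y_box; rewrite lerD2r ler_nat.
pose f (n : 'I_(b ^ m)) := index_vec phi m n.
have f_inj : injective f.
  move=> n n' /(index_vec_inj phiK phi0 (ltn_ord n) (ltn_ord n')).
  exact: val_inj.
rewrite -(card_imset _ f_inj); apply: subset_leq_card.
apply/fintype.subsetP => _ /imsetP[n + ->]; rewrite !inE => /forallP hn.
apply/forallP => i; have /andP[_] := hn i; move=> /(digits_val_lt b_gt1) h.
apply: lex_below_eq (h _ (Y_lt _)) => [j _|j]; last by rewrite ltn_pmod// ltnW.
by rewrite /X /f (coord_digit_Some phi_inv phi0 p a shift i j (ltn_ord n)).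
Qed.

End Discrepancy.
(** * Numerical bounds *)

(** [(b - 1) / b >= 1 / 2] since the digits of the corner are [b - 1], so the
    bound keeps the factor [b^-d] instead of [b^-(d + 1)]. *)
Lemma gain_ge (R : realFieldType) (b d n G : nat) (c : R) : (1 < b)%N ->
  0 <= c -> c <= G%:R ->
  2 ^- 2 * b%:R ^- d * c ^+ n <= (G ^ n)%:R * (b.-1%:R * b%:R ^- d.+1).
Proof.
move=> b1 c0 cG; have b0 : 0 < b%:R :> R by rewrite ltr0n ltnW.
rewrite mulrC natrX; apply: ler_pM.
- by rewrite exprn_ge0.
- by rewrite mulr_ge0 ?invr_ge0 ?exprn_ge0 ?ltW.
- by apply: lerXn2r; rewrite ?nnegrE ?ler0n.
rewrite [_ ^+ d.+1]exprS [(b%:R * _)^-1]invfM mulrA; apply: ler_wpM2r; first by rewrite invr_ge0 exprn_ge0// ltW.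
rewrite ler_pdivlMr//; have : 2 <= b%:R :> R by rewrite (ler_nat _ 2).
have -> : b.-1%:R = b%:R - 1 :> R by rewrite -subn1 natrB// ltnW.
lra.
Qed.

(** The main part of the left-hand side is at most [3 * m / (4 * s)], and the lower
    bound on [m] makes [5 * m / 8] larger than what [t] and the rounding of the
    quotient add to it. *)
Lemma sequence_fits (k t s e m : nat) : (t <= k)%N -> (2 <= k)%N -> (2 <= s)%N ->
  (1 <= e)%N -> (9 * k * e * s * (s + 1) <= m)%N ->
  (2 * t + 2 * (s + 1) * (k.+1 * (m %/ (4 * k * s * (s + 1))).+1) <= m)%N.
Proof.
move=> tk k2 s2 e1 hm; have := leq_divM m (4 * k * s * (s + 1)).
move: (m %/ _)%N => g gm.
have hm' : (9 * k * s * (s + 1) <= m)%N.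
  by apply: leq_trans hm; rewrite -!mulnA leq_mul2l leq_mul2l; nia.
have h1 : (2 * (k * (s + 1)) <= k * s * (s + 1))%N by nia.
have h2 : (2 * (g * (k * (s + 1))) <= g * (k * s * (s + 1)))%N by nia.
have h3 : (2 * ((s + 1) * k.+1) <= 3 * (k * (s + 1)))%N by nia.
have h4 : (2 * (g * ((s + 1) * k.+1)) <= 3 * (g * (k * (s + 1))))%N by nia.
have h5 : (3 * k <= k * (s + 1))%N by nia.
have gm' : (4 * (g * (k * s * (s + 1))) <= m)%N by move: gm; nia.
have -> : (2 * (s + 1) * (k.+1 * g.+1)
   = 2 * (g * ((s + 1) * k.+1)) + 2 * ((s + 1) * k.+1))%N by nia.
move: hm' h1 h2 h3 h4 h5 gm'.
have -> : (9 * k * s * (s + 1) = 9 * (k * s * (s + 1)))%N by nia.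
move: (k * s * (s + 1))%N (g * (k * s * (s + 1)))%N (k * (s + 1))%N
  (g * (k * (s + 1)))%N ((s + 1) * k.+1)%N (g * ((s + 1) * k.+1))%N.
lia.
Qed.

(** The left-hand side is [4 * B], where [B] is the largest sum of near positions
    for [k = d + t] and [n = s - 1].  The main term [h / (3 * n)] of [B] is at most
    [h / 6], and the rounding of [G] adds at most [h / 12]. *)
Lemma net_fits (R : realFieldType) (k n m G : nat) (h : R) : (3 <= k)%N ->
  (2 <= n)%N -> 8 * k%:R * n%:R ^+ 2 <= h ->
  G%:R <= h / (4 * k * n ^ 2)%:R + 1 ->
  4 * (k.+1 * G * n)%:R <= h.
Proof.
move=> k3 n2 hh hG.
have kR : 3 <= k%:R :> R by rewrite (ler_nat R 3).
have nR : 2 <= n%:R :> R by rewrite (ler_nat R 2).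
move: hG; rewrite !natrM -[k.+1%:R]natr1; move: hh; rewrite expr2; move: (k%:R) (n%:R) (G%:R) kR nR.
move=> kk nn g kR nR hh hG.
have D0 : 0 < 4 * kk * (nn * nn) by rewrite !mulr_gt0; lra.
have gD : (g - 1) * (4 * kk * (nn * nn)) <= h by rewrite -ler_pdivlMr// lerBlDr.
have h0 : 0 <= h by apply: le_trans hh; rewrite !mulr_ge0; lra.
have kn0 : 0 <= kk * nn by rewrite mulr_ge0; lra.
have gD' : 8 * ((g - 1) * (kk * nn)) <= h.
  have [g1|g1] := lerP 1 g; last by apply: le_trans h0; nra.
  apply: le_trans gD; have : 0 <= (g - 1) * (kk * nn) by rewrite mulr_ge0; lra.
  nra.
have kn : 16 * (kk * nn) <= h by apply: le_trans hh; nra.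
have hk : 3 * (kk + 1) <= 4 * kk by lra.
have [g0|g0] := lerP 0 g; last by apply: le_trans h0; nra.
have gn0 : 0 <= g * nn by rewrite mulr_ge0; lra.
have : 3 * ((kk + 1) * g * nn) <= 4 * (kk * (g * nn)) by nra.
lra.
Qed.

Lemma mul_expr_frac (R : fieldType) (A u v K : R) (n : nat) :
  A * K ^- n * u ^+ n * v ^+ n = A * (u * v / K) ^+ n.
Proof. by rewrite !exprMn exprVn -!mulrA [K ^- n * _]mulrC -!mulrA. Qed.

Theorem theorem1 (R : realType) (F : finFieldType) (s : nat) (hs : (1 <= s)%N)
    (phi : 'I_#|F| -> F) (phi_inv : F -> 'I_#|F|)
    (phiK : cancel phi phi_inv) (phi_invK : cancel phi_inv phi)
    (phi0 : forall z : 'I_#|F|, z = 0%N :> nat -> phi z = 0)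
    (p : 'I_s -> {poly F})
    (p_deg : forall i, (1 <= pdeg (p i))%N)
    (p_coprime : forall i i', i != i' -> coprimep (p i) (p i'))
    (y : 'I_s -> nat -> nat -> {poly F})
    (y_indep : forall (i : 'I_s) (j : nat), (1 <= j)%N ->
       lin_indep_mod (p i) (pdeg (p i)) (y i j))
    (a : 'I_s -> nat -> nat -> nat -> F)
    (a_expansion : forall (i : 'I_s) (j k : nat), (1 <= j)%N ->
       (k < pdeg (p i))%N -> expansion (y i j k) (p i ^+ j) (a i j k)) :
  let b := #|F| in
  let e_ := fun i : 'I_s => pdeg (p i) in
  let e0 := (\sum_(i < s) e_ i)%N in
  let e := (\prod_(i < s) e_ i)%N in
  let t := (e0 - s)%N in
  let d := e0 in
  let x := digital_seq phi phi_inv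
             (fun i => niederreiter_matrix (e_ i) (a i)) in
  [/\ admissible R b d x,
      (forall m : nat, (2 <= s)%N ->
         (9 * (d + t) * e * s * (s + 1) <= m)%N ->
         let eta1 : R := s%:R / (s + 1)%:R in
         2 ^- 2 * b%:R ^- d * (Kdts d t (s + 1))%:R ^- s * eta1 ^+ s * m%:R ^+ s
         <= 1 + min_over [set Q : nat | (Q < b ^ m)%N] (fun Q =>
                  min_over (@Ems b m s) (fun w =>
                    max_over [set N : nat | (1 <= N <= b ^ m)%N] (fun N =>
                      N%:R * star_discrepancy N (fun n i =>
                        digits_val R b (doplus b (x (noplus b n Q) i) (w i)))))))
    & (forall (m : nat) (eta2 : R) (i0 : 'I_s), (3 <= s)%N ->
         0 < eta2 < 1 ->
         8 * (d + t)%:R * e%:R * (s - 1)%:R ^+ 2 * eta2^-1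
           + 2 * (1 + t%:R) * eta2^-1 * (1 - eta2)^-1 <= m%:R ->
         eta2 <= min_over
           [set jk : nat * nat |
              [/\ m%:R / 2 - t%:R <= (jk.1 * e_ i0)%:R :> R,
                  (jk.1 * e_ i0 <= m)%N & (jk.2 < e_ i0)%N]]
           (fun jk => 1 - (pdeg (y i0 jk.1 jk.2))%:R / (jk.1 * e_ i0)%:R) ->
         2 ^- 2 * b%:R ^- d * (Kdts d t s)%:R ^- (s - 1) * eta2 ^+ (s - 1)
           * m%:R ^+ (s - 1)
         <= min_over (@Ems b m s) (fun w =>
              (b ^ m)%:R * star_discrepancy (b ^ m) (fun n i =>
                digits_val R b (doplus b (x n i) (w i)))))].

Proof.
move=> b e_ e0 e t d x.
have b_gt1 : (1 < b)%N by exact: card_finNzRing_gt1.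
have bR : 0 < b%:R :> R by rewrite ltr0n ltnW.
have s_le_d : (s <= d)%N.
  rewrite -[X in (X <= _)%N]card_ord -sum1_card; apply: leq_sum => i _.
  exact: p_deg.
have dt_gt0 : (0 < d + t)%N by rewrite addn_gt0 (leq_trans hs s_le_d).
have e_gt0 : (0 < e)%N by apply: prodn_gt0.
have Ems0 m : @Ems b m s !=set0.
  exists (fun=> frac_digits b m 0) => i; exists 0%N => //=.
  by rewrite expn_gt0 ltnW.
split.
- exact: (niederreiter_admissible phiK phi_invK phi0 p_deg p_coprime y_indep a_expansion).
- move=> m s2 hm; lazy zeta; set eta1 := s%:R / (s + 1)%:R.
  apply: ler_wpDl => //.
  apply: lb_le_inf; first by eexists; exists 0%N => //=; rewrite expn_gt0 ltnW.
  move=> _ [Q /= Qm <-]; apply: lb_le_inf.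
    by have [w0 w0E] := Ems0 m; eexists; exists w0.
  move=> _ [w _ <-]; pose D := (4 * (d + t) * s * (s + 1))%N.
  have D_gt0 : (0 < D)%N by rewrite !muln_gt0 dt_gt0 hs addn1.
  (* [eta1 * m / K] is [m / D]. *)
  pose G := (m %/ D).+1.
  have fits : (2 * t + 2 * (s + 1) * ((d + t).+1 * G) <= m)%N.
    apply: (sequence_fits _ _ s2 e_gt0 hm); first exact: leq_addl.
    by rewrite (leq_trans s2)// (leq_trans s_le_d)// leq_addr.
  have [N Nm hN] := sequence_discrepancy R phiK phi_invK phi0 p_deg p_coprime
    y_indep a_expansion w s2 (ltn0Sn _) fits Qm.
  apply: (le_trans (y := N%:R * star_discrepancy N (fun n i =>
     digits_val R b (doplus b (x (noplus b n Q) i) (w i))))); last first.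
    apply: ub_le_sup; last by exists N.
    exists ((b ^ m)%:R * 2) => _ [N' /= /andP[N'0 N'm] <-].
    apply: (@le_trans _ _ (N'%:R * 2)); last by rewrite ler_wpM2r// ler_nat.
    by apply: ler_wpM2l => //; apply: star_discrepancy_le2.
  apply: le_trans hN.
  rewrite mul_expr_frac.
  apply: gain_ge => //; first by rewrite !mulr_ge0 ?invr_ge0 ?ler0n.
  have K_gt0 : (0 < Kdts d t (s + 1))%N.
    by rewrite /Kdts addnK !muln_gt0 dt_gt0 hs.
  rewrite ler_pdivrMr ?ltr0n// mulrAC ler_pdivrMr ?ltr0n ?addn1// -!natrM ler_nat.
  apply: (leq_trans (leq_mul (leqnn s) (ltnW (ltn_ceil m D_gt0)))).
  by apply: eq_leq; rewrite /Kdts -/G /D !addn1 subSS subn0 -mulnn; ring.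
move=> m eta2 i0 s3 /andP[eta0 eta1] hm h_eta.
have s1 : (2 <= s.-1)%N by rewrite -ltnS prednK// ltnW// ltnW.
pose k := (d + t)%N.
have k3 : (3 <= k)%N by rewrite (leq_trans s3)// (leq_trans s_le_d)// leq_addr.
pose h := eta2 * m%:R.
have h_ge : 8 * k%:R * s.-1%:R ^+ 2 <= h.
  have : 8 * k%:R * e%:R * (s - 1)%:R ^+ 2 * eta2^-1 <= m%:R.
    apply: le_trans hm; rewrite lerDl; apply: mulr_ge0; last first.
      by rewrite invr_ge0 subr_ge0 ltW.
    apply: mulr_ge0; last by rewrite invr_ge0 ltW.
    by rewrite mulr_ge0// addr_ge0.
  rewrite ler_pdivrMr// [m%:R * _]mulrC subn1 => /(le_trans _); apply.
  apply: ler_wpM2r; first exact: exprn_ge0.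
  by rewrite ler_peMr ?mulr_ge0 ?ler0n// ler1n.
pose c := h / (4 * k * s.-1 ^ 2)%:R.
have h0 : 0 <= h by rewrite mulr_ge0 ?ler0n ?ltW.
have c0 : 0 <= c by rewrite divr_ge0 ?ler0n.
pose G := (Num.truncn c).+1.
have /andP[Gc cG] := truncn_itv c0.
have B_le : 4 * (k.+1 * G * s.-1)%:R <= h.
  by apply: net_fits h_ge _ => //; rewrite -natr1 lerD2r.
pose B := (k.+1 * G * s.-1)%N.
(* The far rows that occur have denominators of degree [J = j * e_ i0 > m - t - B];
   it is enough to have [B + t < eta2 * J], for which [B] and [t] must be at most
   about [h / 4]. *)
have t_le : 4 * t%:R <= h - 4.
  apply: (@le_trans _ _ (8 * k%:R * s.-1%:R ^+ 2 - 4)); last by rewrite lerD2r.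
  have tk : t%:R + 3 <= k%:R :> R.
    by rewrite natrD addrC lerD2r (ler_nat R 3) (leq_trans s3).
  have sR : 2 <= s.-1%:R :> R by rewrite (ler_nat R 2).
  have kR : 3 <= k%:R :> R by rewrite (ler_nat R 3).
  have t0 : 0 <= t%:R :> R by [].
  have n4 : 4 <= s.-1%:R ^+ 2 :> R by rewrite expr2; nra.
  have : 0 <= k%:R * (s.-1%:R ^+ 2 - 4) :> R by rewrite mulr_ge0// subr_ge0.
  nra.
have hm_le : h <= m%:R by rewrite ler_piMl ?ler0n// ltW.
have B_t_m : (t + B <= m)%N.
  rewrite -(ler_nat R) natrD; move: B_le t_le hm_le; rewrite -/B; lra.
apply: lb_le_inf; first by have [w0 w0E] := Ems0 m; eexists; exists w0.
move=> _ [w _ <-].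
rewrite mul_expr_frac /Kdts !subn1.
apply: (le_trans (gain_ge d s.-1 b_gt1 c0 (ltW cG))).
apply: (net_discrepancy R phiK phi_invK phi0 p_deg p_coprime y_indep a_expansion
  (i0 := i0)) => // j l /andP[j_lo j_hi] l_lt.
pose J := (j * e_ i0)%N.
have J_lo : (m < J + (t + B))%N.
  by rewrite -[X in (X < _)%N](subnK B_t_m) ltn_add2r; exact: j_lo.
have J_lo' : m%:R + 1 <= J%:R + t%:R + B%:R :> R.
  by rewrite natr1 -!natrD -addnA ler_nat.
have J_gt0 : 0 < J%:R :> R by move: B_le t_le hm_le J_lo'; rewrite -/B; lra.
have deg_le : (pdeg (y i0 j l))%:R <= (1 - eta2) * J%:R.
  rewrite -ler_pdivrMr// lerBrDl -lerBrDr; apply: (le_trans h_eta).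
  apply: ge_inf; last first.
    exists (j, l) => //; split => //=; rewrite -/J.
    by move: B_le t_le hm_le J_lo'; rewrite -/B; lra.
  exists 0 => _ [[j' l'] /= [_ _ l'_lt] <-].
  rewrite subr_ge0; have [->|j'_gt0] := posnP j'.
    by rewrite mul0n invr0 mulr0 ler01.
  have J'_gt0 : (0 < j' * e_ i0)%N by rewrite muln_gt0 j'_gt0 p_deg.
  rewrite ler_pdivrMr ?ltr0n// mul1r ler_nat.
  have := leq_sub2r 1 (expansion_size (a_expansion i0 j' l' j'_gt0 l'_lt)).
  by rewrite !subn1 size_exp mulnC.
change (B + t + pdeg (y i0 j l) < J)%N; rewrite -(ltr_nat R).
rewrite (natrD _ (B + t)) (natrD _ B).
have : eta2 * (m%:R + 1 - t%:R - B%:R) <= eta2 * J%:R.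
  by apply: ler_wpM2l; [exact: ltW|lra].
have : 0 <= (1 - eta2) * (t%:R + B%:R).
  by apply: mulr_ge0; [rewrite subr_ge0 ltW|rewrite addr_ge0].
move: B_le t_le deg_le eta0; rewrite -/B /h.
move: (B%:R) (t%:R) (J%:R) (m%:R) ((pdeg _)%:R) => B' t' J' m' deg'.
nra.
Qed.
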